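(* Let $p$ be a prime number. The quasi-abelian category $\mathbf{PAb}( p)$ of pro-$p$ Polish abelian groups has enough injectives and homological dimension $1$.
   Context: A Polish abelian group is an abelian topological group whose topology is Polish. An abelian Polish Lie group is a Polish abelian group isomorphic to $\mathbb{R}^{n}\oplus \mathbb{T}^{d}\oplus D$ with $n,d\in\omega$ and $D$ countable discrete. For a Polish abelian group $G$, $\mathcal{N}(G)$ is the set of closed subgroups $N$ with $G/N$ a Lie group. $G$ is pro-Lie if every neighborhood of $0$ contains an element of $\mathcal{N}(G)$. A locally compact Polish abelian group $A$ is a topological $p$-group if $p^{n}x\to 0$ for every $x\in A$ (equivalently, $A$ has a basis of zero neighborhoods consisting of open subgroups $U$ such that $A/U$ is a $p$-group). A pro-$p$ Polish abelian group is a pro-Lie Polish abelian group $G$ such that every element of $\mathcal{N}(G)$ contains some $N\in\mathcal{N}(G)$ for which $G/N$ is a topological $p$-group. $\mathbf{PAb}(p)$ is the category of pro-$p$ Polish abelian groups and continuous homomorphisms. Short exact sequences are the sequences $0\to A\to B\to C\to 0$ of continuous homomorphisms that are algebraically exact with $A\to B$ a homeomorphism onto a closed subgroup. An object $I$ is injective if $\mathrm{Hom}(-,I)$ maps short exact sequences to short exact sequences of abelian groups; the category has enough injectives if every object admits an injective continuous homomorphism with closed image into an injective object. For an exact category $\mathcal{A}$, $\mathrm{Ext}^{n}(A,B):=\mathrm{Hom}_{\mathrm{D}(\mathcal{A})}(A,B[n])$ with $\mathrm{D}(\mathcal{A})$ the derived category (equivalently, Yoneda $n$-extensions for $n\ge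 1$), and the homological dimension is the least $d$ such that $\mathrm{Ext}^{n}=0$ for all $n>d$. *)

(* Defs.v *)
From HB Require Import structures.
From Stdlib Require Import Relation_Operators.
From mathcomp Require Import all_boot all_order all_algebra.
From mathcomp Require Import all_classical all_reals all_analysis.

Set Implicit Arguments.
Unset Strict Implicit.
Unset Printing Implicit Defensive.

Import Order.TTheory GRing.Theory Num.Theory.
Import numFieldNormedType.Exports.

Local Open Scope classical_set_scope.
Local Open Scope ring_scope.

(** * Quotients of topological abelian groups *)

Definition tquot (G : topologicalZmodType) (N : zmodClosed G) : Type :=
  quotient_topology (Quotient.quot N).

Section tquot_topologicalZmodType.
Context (G : topologicalZmodType) (N : zmodClosed G).
Local Notation Q := (tquot N).
Local Notation QT := (quotient_topology (Quotient.quot N)).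

HB.instance Definition _ := Topological.copy Q QT.
HB.instance Definition _ := GRing.isZmodule.Build Q
  (@Quotient.addqA G N) (@Quotient.addqC G N)
  (@Quotient.add0q G N) (@Quotient.addNq G N).

Definition tquot_pi (x : G) : Q := \pi_(Quotient.quot N)%qT x.

Lemma tquot_pi_is_additive : zmod_morphism tquot_pi.
Proof.
move=> x y; have H := @Quotient.pi_add G N x (- y).
by have H' := @Quotient.pi_opp G N y; rewrite /tquot_pi H H'.
Qed.

HB.instance Definition _ :=
  GRing.isZmodMorphism.Build G Q tquot_pi tquot_pi_is_additive.

Lemma tquot_pi_continuous : continuous tquot_pi.
Proof. exact: (@pi_continuous G (Quotient.quot N)). Qed.

Lemma tquot_pi_surj (y : Q) : exists x, tquot_pi x = y.
Proof. by exists (repr (y : Quotient.quot N)); exact: reprK. Qed.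

Lemma tquot_pi_eq (x y : G) : (tquot_pi x = tquot_pi y) <-> x - y \in N.
Proof.
rewrite /tquot_pi Quotient.idealrBE; split; first by move=> ->.
by move/eqP.
Qed.

Lemma tquot_pi_open (U : set G) : open U -> open (tquot_pi @` U).
Proof.
move=> oU; suff : open (tquot_pi @^-1` (tquot_pi @` U)) by [].
have -> : tquot_pi @^-1` (tquot_pi @` U) =
    \bigcup_(n in [set n | n \in N]) ((fun x => x - n) @^-1` U).
  apply/seteqP; split => x /=.
    move=> [u Uu /esym/tquot_pi_eq xuN]; exists (x - u) => //=.
    by rewrite opprB addrC subrK.
  move=> [n nN /= Uxn]; exists (x - n) => //.
  by apply/tquot_pi_eq; rewrite addrAC subrr add0r rpredN.
apply: bigcup_open => n _; apply: open_comp => // x _.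
apply: (@continuous_comp _ _ _ (fun x => (x, n)) (fun x : G * G => x.1 - x.2)).
  by apply: cvg_pair; [exact: cvg_id|exact: cvg_cst].
exact: sub_continuous.
Qed.

Lemma tquot_pi_nbhs (x : G) (A : set G) :
  nbhs x A -> nbhs (tquot_pi x) (tquot_pi @` A).
Proof.
rewrite nbhsE => -[U [oU Ux] UA].
apply: (@filterS _ _ _ (tquot_pi @` U)); first exact: image_subset.
by apply: open_nbhs_nbhs; split; [exact: tquot_pi_open|exists x].
Qed.

Lemma tquot_sub_continuous : continuous (fun z : Q * Q => z.1 - z.2).
Proof.
move=> [a b]; have [x <-] := tquot_pi_surj a; have [y <-] := tquot_pi_surj b.
move=> W /=; rewrite -raddfB => /tquot_pi_continuous.
move=> /(@sub_continuous G (x, y))[[A B] [/= nA nB] AB].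
exists (tquot_pi @` A, tquot_pi @` B).
  by split; exact: tquot_pi_nbhs.
move=> [_ _] /= [[u Au <-] [v Bv <-]]; rewrite -raddfB.
exact: (AB (u, v)).
Qed.

HB.instance Definition _ :=
  PreTopologicalNmodule_isTopologicalZmodule.Build Q tquot_sub_continuous.

End tquot_topologicalZmodType.

(** * Polish groups and Lie groups *)

HB.instance Definition _ (G : PreTopologicalZmodule.type) (m n : nat) :=
  Topological.on 'M[G]_(m, n).
HB.instance Definition _ (G H : PreTopologicalZmodule.type) :=
  Topological.on (G * H)%type.

Definition topgroup_iso (G H : PreTopologicalZmodule.type) :=
  exists (f : {additive G -> H}) (g : H -> G),
    [/\ cancel f g, cancel g f, continuous f & continuous g].

Section polish_groups.
Context (R : realType).

Definition separable (T : topologicalType) :=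
  exists2 D : set T, countable D & dense D.

Definition completely_metrizable (T : topologicalType) :=
  exists (M : metricType R) (f : T -> M) (g : M -> T),
    [/\ cancel f g, cancel g f, continuous f, continuous g &
        forall F : set_system M, ProperFilter F -> cauchy F ->
          exists l : M, F --> l].

Definition polish (T : topologicalType) :=
  separable T /\ completely_metrizable T.

(** [Num.int_num_subdef] is the predicate underlying the qualifier [Num.int]. *)
Definition circle : Type :=
  tquot (GRing.ZmodClosed.clone R (@Num.int_num_subdef R) _).

HB.instance Definition _ := TopologicalZmodule.on circle.

Definition polish_lie_group (G : topologicalZmodType) :=
  polish G /\
  exists (n d : nat) (D : topologicalZmodType),
    [/\ countable [set: D], (forall A : set D, open A) &
        topgroup_iso G ('rV[R]_n * 'rV[circle]_d * D)%type].

Definition lie_quotient (G : topologicalZmodType) (N : zmodClosed G) :=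
  closed [set` N] /\ polish_lie_group (tquot N).

Definition pro_lie (G : topologicalZmodType) :=
  forall U : set G, nbhs 0 U ->
    exists2 N : zmodClosed G, lie_quotient N & [set` N] `<=` U.

Definition topological_p_group (p : nat) (A : topologicalZmodType) :=
  [/\ polish A, locally_compact [set: A] &
      forall x : A, (fun n : nat => x *+ (p ^ n)%N) @ \oo --> (0 : A)].

Definition pro_p (p : nat) (G : topologicalZmodType) :=
  pro_lie G /\
  forall M : zmodClosed G, lie_quotient M ->
    exists N : zmodClosed G,
      [/\ lie_quotient N, [set` N] `<=` [set` M] &
          topological_p_group p (tquot N)].

End polish_groups.

(** * The category PAb(p) *)

Record pab (R : realType) (p : nat) := Pab {
  pab_group :> topologicalZmodType;
  pab_polish : polish R pab_group;
  pab_pro_p : pro_p R p pab_group }.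

Section category.
Context (R : realType) (p : nat).
Local Notation obj := (pab R p).

Record pab_hom (A B : obj) := Hom {
  hom_fun :> {additive A -> B};
  hom_continuous : continuous hom_fun }.

Definition hom_id (A : obj) : pab_hom A A := @Hom A A idfun (fun x => cvg_id).

Lemma hom_comp_continuous (A B C : obj) (g : pab_hom B C) (f : pab_hom A B) :
  continuous (g \o f).
Proof.
by move=> x; apply: continuous_comp; apply: hom_continuous.
Qed.

Definition hom_comp (A B C : obj) (g : pab_hom B C) (f : pab_hom A B) :
    pab_hom A C :=
  @Hom A C (g \o f) (@hom_comp_continuous A B C g f).

Definition embedding_onto_closed (A B : obj) (f : pab_hom A B) :=
  [/\ injective f, closed (range f) &
      forall U : set A, open U ->
        exists2 V : set B, open V & f @` U = V `&` range f].

Definition short_exact (A B C : obj) (f : pab_hom A B) (g : pab_hom B C) :=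
  [/\ embedding_onto_closed f, range f = [set b | g b = 0] &
      range g = [set: C]].

(** The sequence [0 -> Hom(C, I) -> Hom(B, I) -> Hom(A, I) -> 0] is exact. *)
Definition injective_object (I : obj) :=
  forall (A B C : obj) (f : pab_hom A B) (g : pab_hom B C), short_exact f g ->
    [/\ injective (fun h : pab_hom C I => hom_comp h g),
        range (fun h : pab_hom C I => hom_comp h g) =
          [set h : pab_hom B I | forall a : A, hom_comp h f a = 0] &
        range (fun h : pab_hom B I => hom_comp h f) = [set: pab_hom A I]].

Definition enough_injectives :=
  forall A : obj, exists2 I : obj, injective_object I &
    exists2 f : pab_hom A I, injective f & closed (range f).

(** * Yoneda Ext *)

Record extension (A B : obj) := Extension {
  ext_mid : obj;
  ext_inc : pab_hom B ext_mid;
  ext_prj : pab_hom ext_mid A;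
  ext_exact : short_exact ext_inc ext_prj }.

(** An [n]-extension [0 -> B -> X_n -> ... -> X_1 -> A -> 0] is encoded as the
    [n] short exact sequences it is spliced from: the one starting at [B]
    comes first, and its cokernel [Z] is the left end of the remaining
    [(n - 1)]-extension.  In degree [0] one gets [Ext^0 = Hom]. *)
Fixpoint yoneda (n : nat) (A B : obj) : Type :=
  match n with
  | 0 => pab_hom A B
  | n'.+1 =>
    match n' with
    | 0 => extension A B
    | _.+1 => {Z : obj & (extension Z B * yoneda n' A Z)%type}
    end
  end.

Definition extension_map (A A' B B' : obj) (a : pab_hom A A') (b : pab_hom B B')
    (x : extension A B) (y : extension A' B') : Prop :=
  exists e : pab_hom (ext_mid x) (ext_mid y),
    (forall t : B, e (ext_inc x t) = ext_inc y (b t)) /\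
    (forall t : ext_mid x, ext_prj y (e t) = a (ext_prj x t)).

(** Existence of a chain map from [x] to [y] which is [a] and [b] on the two
    ends; the maps between the intermediate cokernels [Z] are induced by the
    maps between the middle terms. *)
Fixpoint yoneda_map (n : nat) (A A' B B' : obj) (a : pab_hom A A')
    (b : pab_hom B B') : yoneda n A B -> yoneda n A' B' -> Prop :=
  match n return yoneda n A B -> yoneda n A' B' -> Prop with
  | 0 => fun x y => forall t : A, b (x t) = y (a t)
  | n'.+1 =>
    match n' as m return
      (forall Z Z' : obj,
         pab_hom Z Z' -> yoneda m A Z -> yoneda m A' Z' -> Prop) ->
      yoneda m.+1 A B -> yoneda m.+1 A' B' -> Prop with
    | 0 => fun _ x y => extension_map a b x y
    | m.+1 => fun rec x y =>
      exists z : pab_hom (projT1 x) (projT1 y),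
        extension_map z b (projT2 x).1 (projT2 y).1 /\
        rec _ _ z (projT2 x).2 (projT2 y).2
    end (fun Z Z' z => @yoneda_map n' A A' Z Z' a z)
  end.

(** Yoneda equivalence: the elements of [Ext^n(A, B)] are its classes. *)
Definition yoneda_equiv (n : nat) (A B : obj) :
    yoneda n A B -> yoneda n A B -> Prop :=
  clos_refl_sym_trans _ (@yoneda_map n A A B B (hom_id A) (hom_id B)).

(** The group [Ext^n(A, B)] always has its zero class, so it vanishes exactly
    when it has no other element. *)
Definition Ext_eq0 (n : nat) (A B : obj) :=
  forall x y : yoneda n A B, yoneda_equiv x y.

Definition Ext_vanish_above (d : nat) :=
  forall n : nat, (d < n)%N -> forall A B : obj, Ext_eq0 n A B.

Definition homological_dimension (d : nat) :=
  Ext_vanish_above d /\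
  forall d' : nat, Ext_vanish_above d' -> (d <= d')%N.

End category.

(* Main.v *)
(* A pro-p Polish abelian group is a Polish abelian group with a countable basis
   (U_n) at 0 of open subgroups such that every G / U_n is a countable p-group:
   a Lie quotient that is a p-group is discrete, and conversely Lie groups have
   no small subgroups.

   A group I having such a basis of p-divisible open subgroups, the first being
   I itself, is injective: a homomorphism A -> I with A closed in B is extended
   one element of B at a time, the new value being the limit of a sequence that
   solves the constraints modulo each U_n in turn. Hom(-, I) is left exact by
   the open mapping theorem. Every A embeds in the product of the divisible
   hulls of the A / U_n, which is such an I, and a quotient of such an I by a
   closed subgroup is again of this kind. So every A has an injective resolution
   of length 1, and Ext^n = 0 for n >= 2. Finally Ext^1 <> 0: an extension of
   I / B by B = Z/p with p-divisible middle term I is not split. *)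

Require Import Defs.
From HB Require Import structures.
From Stdlib Require Import Relation_Operators.
From mathcomp Require Import all_boot all_order all_algebra.
From mathcomp Require Import all_classical all_reals all_analysis.
From mathcomp Require Import lra.

Set Implicit Arguments.
Unset Strict Implicit.
Unset Printing Implicit Defensive.

Import Order.TTheory GRing.Theory Num.Theory.
Import numFieldNormedType.Exports.

Local Open Scope classical_set_scope.
Local Open Scope ring_scope.

(** * Non-archimedean Polish groups *)

(** The obstacle in extending a homomorphism from a closed subgroup is continuity: the subgroup need
    not be open, and a union of a chain of continuous homomorphisms need not be continuous. So
    continuity is made quantitative before Zorn's lemma is applied: the basis of [B] is reindexed to
    a sequence [O] such that the given map carries level n of [O] into level n of the target, and
    every partial extension must respect these same levels. Adjoining an element then imposes
    constraints level by level. Since [B] is p-torsion modulo each level, those at one level reduce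
    to a single equation with a p-power coefficient. Divisibility of every [W n], not just of [I],
    solves it by a correction small enough for the successive values to converge. Divisibility of a
    filtration also passes to images, which is why quotients stay injective. Higher Ext is treated
    without long exact sequences: once an injective resolution of length 1 is available, one
    explicit extension receives a map from every other with the same ends. *)

Section subgroup_of_set.
Context (G : zmodType) (S : set G).
Hypothesis S0 : S 0.
Hypothesis SB : forall x y, S x -> S y -> S (x - y).

Let pred_of_S : {pred G} := fun x => `[< S x >].

Let pred_of_S_closed : zmod_closed pred_of_S.
Proof.
split=> [|x y /asboolP Sx /asboolP Sy]; apply/asboolP => //.
exact: SB.
Qed.

Definition subgroup_of_set : zmodClosed G :=
  HB.pack pred_of_S (GRing.isZmodClosed.Build G pred_of_S pred_of_S_closed).

Lemma in_subgroup_of_set x : (x \in subgroup_of_set) <-> S x.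
Proof. by split=> [/asboolP|?]; last exact/asboolP. Qed.

End subgroup_of_set.

Section nonarch.
Context (G : topologicalZmodType) (U : nat -> zmodClosed G).

Definition nonarch_basis :=
  [/\ forall n x, x \in U n.+1 -> x \in U n,
      forall n, nbhs 0 [set` U n] &
      forall A, nbhs 0 A -> exists n, [set` U n] `<=` A].

Definition nonarch_separated := forall x, (forall n, x \in U n) -> x = 0.

(** Sequences with this fixed rate suffice, because every Cauchy sequence has such a subsequence. *)
Definition nonarch_complete := forall x : nat -> G,
  (forall n, x n.+1 - x n \in U n) -> exists l, forall n, l - x n \in U n.

Definition nonarch_separable :=
  exists s : nat -> G, forall n x, exists i, x - s i \in U n.

Definition nonarch_polish := [/\ nonarch_basis, nonarch_separated,
  nonarch_complete & nonarch_separable].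

Definition nonarch_ptorsion p := forall n x, exists k, x *+ (p ^ k)%N \in U n.

Definition nonarch_pdivisible (p : nat) :=
  forall n x, x \in U n -> exists2 y, y \in U n & y *+ p = x.

Lemma nonarch_anti : nonarch_basis -> forall m n x, (m <= n)%N ->
  x \in U n -> x \in U m.
Proof.
move=> [dU _ _] m n x /subnK <-; elim: (n - m)%N => // k IH /dU; exact: IH.
Qed.

End nonarch.

Lemma translate_cvg (G : topologicalZmodType) (a b : G) :
  (fun z => a + z) @ b --> a + b.
Proof.
apply: (@continuous_comp _ _ _ (fun z => (a, z)) (fun x : G * G => x.1 + x.2)).
  by apply: cvg_pair; [exact: cvg_cst|exact: cvg_id].
exact: add_continuous.
Qed.

Lemma nbhs_translate (G : topologicalZmodType) (x : G) (A : set G) :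
  nbhs x A <-> nbhs 0 [set z | A (x + z)].
Proof.
split=> nA; first by apply: (@translate_cvg G x 0); rewrite addr0.
have h := @translate_cvg G (- x) x; rewrite addNr in h.
have : nbhs x [set z | A (x + (- x + z))] := h _ nA.
by apply: filterS => z /=; rewrite addrA addrN add0r.
Qed.

Lemma additive_continuous0 (G H : topologicalZmodType) (f : {additive G -> H}) :
  (forall A, nbhs 0 A -> nbhs 0 (f @^-1` A)) -> continuous f.
Proof.
move=> cf x A /nbhs_translate nA; apply/nbhs_translate.
by apply: filterS (cf _ nA) => z /=; rewrite raddfD.
Qed.

Lemma nbhs_subgroup_open (G : topologicalZmodType) (U : zmodClosed G) :
  nbhs 0 [set` U] -> open [set` U].
Proof.
move=> nU; rewrite openE => x /= Ux; apply/nbhs_translate.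
by apply: filterS nU => z /= Uz; rewrite rpredD.
Qed.

Lemma nbhs_subgroup_closed (G : topologicalZmodType) (U : zmodClosed G) :
  nbhs 0 [set` U] -> closed [set` U].
Proof.
move=> nU x /(_ [set y | y - x \in U]) [].
  apply/nbhs_translate; apply: filterS nU => z /=.
  by rewrite addrAC subrr add0r.
by move=> y [/= Uy Uyx]; rewrite -(subKr y x) rpredB.
Qed.

Lemma nbhs_nonarch (G : topologicalZmodType) (U : nat -> zmodClosed G)
    (bU : nonarch_basis U) (x : G) (A : set G) :
  nbhs x A <-> exists n, forall y, y - x \in U n -> A y.
Proof.
have [dU nU sU] := bU; split=> [/nbhs_translate/sU[n Un]|[n Un]].
  exists n => y /Un /=; by rewrite addrC subrK.
apply/nbhs_translate; apply: filterS (nU n) => z /= Uz; apply: Un.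
by rewrite addrAC subrr add0r.
Qed.

(** * The ultrametric of a filtration *)

Section metrization.
Context (R : realType) (G : topologicalZmodType) (U : nat -> zmodClosed G).
Hypothesis pU : nonarch_polish U.

Definition nval (z : G) : R :=
  match pselect (exists n, z \notin U n) with
  | left e => (ex_minn e).+1%:R^-1
  | right _ => 0
  end.

Lemma nval_ge0 z : 0 <= nval z.
Proof. by rewrite /nval; case: pselect => // e; rewrite invr_ge0. Qed.

Lemma nval_ge z n : z \notin U n -> n.+1%:R^-1 <= nval z.
Proof.
move=> zn; rewrite /nval; case: pselect => [e|[]]; last by exists n.
case: ex_minnP => m _ /(_ _ zn) mn.
by rewrite lef_pV2 ?posrE// ler_nat ltnS.
Qed.

Lemma nval_le z (r : R) : 0 <= r ->
  (forall n, z \notin U n -> n.+1%:R^-1 <= r) -> nval z <= r.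
Proof.
move=> r0 h; rewrite /nval; case: pselect => [e|//].
by case: ex_minnP => m zm _; exact: h.
Qed.

Lemma nval_lt z n : (nval z < n.+1%:R^-1) = (z \in U n).
Proof.
apply/idP/idP => [|zn]; first by apply: contraTT => /nval_ge; rewrite -leNgt.
rewrite /nval; case: pselect => [e|_]; last by rewrite invr_gt0.
case: ex_minnP => m zm _; rewrite ltf_pV2 ?posrE// ltr_nat ltnS ltnNge.
apply: contra zm => mn; apply: nonarch_anti mn zn; by case: pU.
Qed.

(** A copy of the carrier, so that the metric topology can be compared with the one [G] already
    has. *)
Definition ultrametric : Type := G.
HB.instance Definition _ := GRing.Zmodule.on ultrametric.

Let dist (x y : ultrametric) : R := nval ((x : G) - y).

Let distxx x : dist x x = 0.
Proof.
apply/eqP; rewrite eq_le nval_ge0 andbT; apply: nval_le => // n.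
by rewrite subrr rpred0.
Qed.

Let dist_positivity x y : dist x y = 0 -> x = y.
Proof.
move=> d0; apply/eqP; rewrite -subr_eq0; apply/eqP.
have [_ sepU _ _] := pU; apply: sepU => n; rewrite -nval_lt.
by rewrite [nval _]d0 invr_gt0.
Qed.

Let dist_sym x y : dist x y = dist y x.
Proof.
suff h a b : dist a b <= dist b a by apply/eqP; rewrite eq_le !h.
apply: nval_le => [|n]; first exact: nval_ge0.
by rewrite -opprB rpredN => /nval_ge.
Qed.

Let dist_triangle y x z : dist x z <= dist x y + dist y z.
Proof.
apply: nval_le => [|n]; first by rewrite addr_ge0 ?nval_ge0.
have -> : (x : G) - z = (x - y) + (y - z) by rewrite addrA subrK.
move=> h; have [xy|xy] := boolP ((x : G) - y \in U n); last first.
  by rewrite (le_trans (nval_ge xy))// lerDl nval_ge0.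
have /nval_ge yz : (y : G) - z \notin U n.
  by apply: contra h => yz; rewrite rpredD.
by rewrite (le_trans yz)// lerDr nval_ge0.
Qed.

HB.instance Definition _ := isMetric.Build R ultrametric
  distxx dist_positivity dist_sym dist_triangle.

Lemma ultrametric_ball (x : ultrametric) n :
  ball x (n.+1%:R^-1 : R) = [set y : ultrametric | (x : G) - y \in U n].
Proof. by apply/seteqP; split=> y /=; rewrite ballEmdist /= nval_lt. Qed.

Lemma ultrametric_nbhs (x : ultrametric) (A : set ultrametric) :
  nbhs x A <-> nbhs (x : G) (A : set G).
Proof.
have bU : nonarch_basis U by case: pU.
rewrite -nbhs_ballE; split=> [[e /= e0 eA]|].
  apply/(nbhs_nonarch bU).
  have [n _ /(_ n (leqnn n)) /= ne] := near_infty_natSinv_lt (PosNum e0).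
  exists n => y yx; apply: eA; apply: (@le_ball _ _ _ n.+1%:R^-1).
    exact: ltW.
  by rewrite ultrametric_ball /= -opprB rpredN.
move=> /(nbhs_nonarch bU)[n nA]; exists n.+1%:R^-1; first by rewrite /= invr_gt0.
move=> y /=; rewrite -/(ball x _ y) ultrametric_ball /= => h; apply: nA.
by rewrite -opprB rpredN.
Qed.

Lemma nonarch_polish_polish : polish R G.
Proof.
have [bU sepU compU [s sP]] := pU; split.
  exists (range s); first exact: card_image_le.
  move=> O [x Ox]; rewrite openE => /(_ x Ox)/(nbhs_nonarch bU)[n nO].
  have [i si] := sP n x; exists (s i); split; last by exists i.
  by apply: nO; rewrite -opprB rpredN.
exists ultrametric, id, id; split=> //.
- by move=> x A /ultrametric_nbhs.
- by move=> x A /ultrametric_nbhs.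
move=> F FF cF.
(* Two balls belonging to [F] meet, so their centres differ by an element of the larger level: the
   centres have the rate that [nonarch_complete] asks for. *)
have ex n : exists x : ultrametric, F (ball x (n.+1%:R^-1 : R)).
  have /cauchy_ballP/(_ n.+1%:R^-1) := cF.
  rewrite invr_gt0 ltr0n => /(_ isT)[[P Q] /= [FP FQ] PQ].
  have [x Px] := filter_ex FP; exists x.
  by apply: filterS FQ => y Qy; exact: (PQ (x, y)).
have [x xP] := choice ex.
have [|l lP] := compU x.
  move=> n; have [y [/=]] := filter_ex (filterI (xP n) (xP n.+1)).
  rewrite !ultrametric_ball /= => h1 h2.
  rewrite -(subrKA y) rpredD//; first by case: bU => dU _ _; apply: dU.
  by rewrite -opprB rpredN.
exists l => A /ultrametric_nbhs/(nbhs_nonarch bU)[n nA].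
apply: filterS (xP n) => y; rewrite ultrametric_ball /= => h; apply: nA.
by rewrite -(subrKA (x n)) -opprB -(opprB l) -opprD rpredN rpredD.
Qed.

End metrization.

(** * Discrete quotients and Lie groups *)

Lemma discrete_open (G : topologicalZmodType) :
  nbhs (0 : G) [set 0] -> forall A : set G, open A.
Proof.
move=> n0 A; rewrite openE => x Ax; apply/nbhs_translate.
by apply: filterS n0 => z /= ->; rewrite addr0.
Qed.

Lemma discrete_polish (R : realType) (G : topologicalZmodType) (s : nat -> G) :
  nbhs (0 : G) [set 0] -> (forall x, exists i, x = s i) -> polish R G.
Proof.
move=> n0 sP.
have S0 : [set 0 : G] 0 by [].
have SB (x y : G) : [set 0 : G] x -> [set 0 : G] y -> [set 0 : G] (x - y).
  by move=> /= -> ->; rewrite subr0.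
pose N := subgroup_of_set S0 SB.
have NE x : x \in N <-> x = 0 by exact: in_subgroup_of_set.
apply: (@nonarch_polish_polish _ _ (fun _ => N)); split.
- split=> [//|_|A nA].
    by apply: filterS n0 => x /= x0; apply/NE.
  by exists 0%N => x /= /NE ->; exact: nbhs_singleton.
- by move=> x /(_ 0%N)/NE.
- move=> x xN; exists (x 0%N); elim=> [|n IH]; first by apply/NE; rewrite subrr.
  by rewrite -(subrKA (x n)) rpredD// -opprB rpredN.
- by exists s => _ x; have [i ->] := sP x; exists i; apply/NE; rewrite subrr.
Qed.

Section open_subgroup.
Context (R : realType) (G : topologicalZmodType) (N : zmodClosed G).
Hypothesis nN : nbhs 0 [set` N].
Context (s : nat -> G).
Hypothesis sN : forall x, exists i, x - s i \in N.

Lemma tquot_discrete : nbhs (0 : tquot N) [set 0].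
Proof.
have := tquot_pi_nbhs N nN; rewrite raddf0; apply: filterS => _ [x /= xN <-].
by rewrite -(raddf0 (@tquot_pi G N)); apply/tquot_pi_eq; rewrite subr0.
Qed.

Let sE (y : tquot N) : exists i, y = tquot_pi N (s i).
Proof.
have [x <-] := tquot_pi_surj y; have [i xi] := sN x.
by exists i; apply/tquot_pi_eq.
Qed.

Lemma tquot_discrete_polish : polish R (tquot N).
Proof. exact: (discrete_polish R tquot_discrete sE). Qed.

Let iso0 (x : tquot N) : 'rV[R]_0 * 'rV[circle R]_0 * tquot N := (0, 0, x).

Let iso0_additive : zmod_morphism iso0.
Proof. by move=> x y; rewrite /iso0; congr (_, _, _); rewrite subr0. Qed.

HB.instance Definition _ := GRing.isZmodMorphism.Build _ _ iso0 iso0_additive.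

Lemma lie_quotient_open : lie_quotient R N.
Proof.
split; first exact: nbhs_subgroup_closed.
split; first exact: tquot_discrete_polish.
exists 0%N, 0%N, (tquot N : topologicalZmodType); split.
- have -> : [set: tquot N] = range (tquot_pi N \o s).
    by apply/seteqP; split=> // y _; have [i ->] := sE y; exists i.
  exact: card_image_le.
- exact: discrete_open tquot_discrete.
exists iso0, snd; split=> //.
- by move=> [[v t] x]; rewrite /iso0 /= (thinmx0 v) (thinmx0 t).
- move=> x A [[B C] /= [nB nC] BC]; apply: filterS nC => y Cy.
  by apply: (BC (0, 0, y)); split=> //; exact: nbhs_singleton nB.
- by move=> [a b]; exact: cvg_snd.
Qed.

Lemma tquot_topological_p_group (p : nat) :
  (forall x : G, exists k, x *+ (p ^ k)%N \in N) ->
  topological_p_group R p (tquot N).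
Proof.
move=> pN; split; first exact: tquot_discrete_polish.
- move=> x _.
  exists [set x]; last first.
    split; first exact: compact_set1.
    by rewrite -openC; exact: discrete_open tquot_discrete _.
  by apply: open_nbhs_nbhs; split=> //; exact: (discrete_open tquot_discrete).
- move=> y; have [x <-] := tquot_pi_surj y; have [k xk] := pN x.
  apply: cvg_near_cst; exists k => // n /= kn.
  rewrite -raddfMn -(raddf0 (@tquot_pi G N)); apply/tquot_pi_eq.
  by rewrite subr0 -(subnK kn) expnD mulnC mulrnA rpredMn.
Qed.

End open_subgroup.

(** * Lie groups have no small subgroups *)

Section no_small_subgroups.
Context (R : realType).

Lemma doubling_bounded (r : R) : (forall j, `|r *+ (2 ^ j)%N| < 1) -> r = 0.
Proof.
move=> h; apply/eqP/negPn/negP => r0.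
have := archi_boundP (ltW (_ : 0 < `|r|^-1)); rewrite invr_gt0 normr_gt0 => /(_ r0).
set n := Num.bound _ => rn.
have := h n; rewrite normrMn -mulr_natl ltNge => /negP; apply.
rewrite -ler_pdivrMr ?normr_gt0// mul1r (le_trans (ltW rn))// ler_nat.
exact/ltnW/ltn_expl.
Qed.

Lemma int_small (r : R) : r \is a Num.int -> `|r| < 1 -> r = 0.
Proof.
move=> ri; apply: contraTeq => r0; rewrite -leNgt.
exact: norm_intr_ge1.
Qed.

Definition circle_pi (r : R) : circle R := tquot_pi _ r.

Lemma circle_pi_eq (r s : R) : circle_pi r = circle_pi s <-> r - s \is a Num.int.
Proof. exact: tquot_pi_eq. Qed.

Lemma circle_piMn (r : R) n : circle_pi (r *+ n) = circle_pi r *+ n.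
Proof. exact: raddfMn. Qed.

Definition circle_ball (e : R) : set (circle R) := circle_pi @` [set r | `|r| < e].

(** Radius 1/4 leaves room for one doubling: if r lifts a point and |r| < 1/4, then 2r and the small
    lift of the doubled point differ by an integer of absolute value below 3/4, so they agree. Hence
    one real lift stays bounded under all doublings. *)
Lemma circle_doubling (t : circle R) :
  (forall j, circle_ball 4^-1 (t *+ (2 ^ j)%N)) -> t = 0.
Proof.
move=> h; have [r /= r4 rt] := h 0%N.
rewrite expn0 mulr1n in rt.
have rj j : `|r *+ (2 ^ j)%N| < 4^-1.
  elim: j => [|j IH]; first by rewrite expn0.
  have [s /= s4 st] := h j.+1.
  have : circle_pi (r *+ (2 ^ j.+1)%N) = circle_pi s by rewrite circle_piMn rt st.
  have r2 : `|r *+ (2 ^ j.+1)%N| < 2^-1.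
    rewrite expnS mulnC mulrnA normrMn; lra.
  move=> /circle_pi_eq/int_small rs.
  have : `|r *+ (2 ^ j.+1)%N - s| < 1.
    rewrite (le_lt_trans (ler_normB _ _))//; lra.
  by move=> /rs/eqP; rewrite subr_eq0 => /eqP ->.
have r0 : r = 0 by apply: doubling_bounded => j; rewrite (lt_trans (rj j))//; lra.
by rewrite -rt r0 /circle_pi raddf0.
Qed.

Lemma circle_ball_nbhs (e : R) : 0 < e -> nbhs 0 (circle_ball e).
Proof.
move=> e0; have : nbhs (0 : R) [set r | `|r| < e].
  have := @nbhsx_ballx _ _ (0 : R) e e0; apply: filterS => r.
  by rewrite -ball_normE /= sub0r normrN.
move=> /(tquot_pi_nbhs (GRing.ZmodClosed.clone R (@Num.int_num_subdef R) _)).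
by rewrite raddf0.
Qed.

Context (n d : nat) (D : topologicalZmodType).
Hypothesis oD : forall A : set D, open A.
Local Notation L := ('rV[R]_n * 'rV[circle R]_d * D)%type.

Definition lie_box (e : R) : set L := [set x : L |
  [/\ forall i j, `|x.1.1 i j| < 1, forall i j, circle_ball e (x.1.2 i j) &
      x.2 = 0]].

Lemma lie_box_nbhs (e : R) : 0 < e -> nbhs (0 : L) (lie_box e).
Proof.
move=> e0.
pose V := [set v : 'rV[R]_n | forall i j, `|v i j| < 1].
pose T := [set t : 'rV[circle R]_d | forall i j, circle_ball e (t i j)].
exists ([set y | V y.1 /\ T y.2], [set 0]).
  split=> /=; last by apply: open_nbhs_nbhs; split.
  exists (V, T) => //=; split.
    exists (fun _ _ => [set r : R | `|r| < 1]) => // i j; rewrite mxE.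
    have := @nbhsx_ballx _ _ (0 : R) 1 ltr01; apply: filterS => r.
    by rewrite -ball_normE /= sub0r normrN.
  exists (fun _ _ => circle_ball e) => // i j; rewrite mxE.
  exact: circle_ball_nbhs.
by move=> [[v t] x] /= [[]].
Qed.

Lemma mulrn_mxE (S : zmodType) (m k : nat) (v : 'rV[S]_m) i j :
  (v *+ k) i j = v i j *+ k.
Proof. by elim: k => [|k IH]; rewrite ?mxE// !mulrS mxE IH. Qed.

Lemma lie_mulrnE (v : 'rV[R]_n) (t : 'rV[circle R]_d) (x : D) k :
  ((v, t, x) : L) *+ k = (v *+ k, t *+ k, x *+ k).
Proof. by elim: k => [|k IH] //; rewrite !mulrS IH. Qed.

Lemma lie_no_small_subgroups (x : L) :
  (forall j, lie_box 4^-1 (x *+ (2 ^ j)%N)) -> x = 0.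
Proof.
case: x => [[v t] x] h; congr (_, _, _).
- apply/matrixP => i j; rewrite [RHS]mxE; apply: doubling_bounded => k.
  by have [Vk _ _] := h k; have := Vk i j; rewrite lie_mulrnE /= mulrn_mxE.
- apply/matrixP => i j; rewrite [RHS]mxE; apply: circle_doubling => k.
  by have [_ Tk _] := h k; have := Tk i j; rewrite lie_mulrnE /= mulrn_mxE.
- by have [_ _] := h 0%N; rewrite lie_mulrnE.
Qed.

(* The point with all real coordinates 1 and all circle coordinates 1/(p+1)
   is not p-nilpotent unless there are no such coordinates, because p^k/(p+1)
   is never an integer. *)
Lemma lie_p_group_discrete (p : nat) : prime p ->
  (forall x : L, (fun k => x *+ (p ^ k)%N) @ \oo --> (0 : L)) ->
  nbhs (0 : L) [set 0].
Proof.
move=> pp h.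
have p0 : 0 < (p.+1%:R : R)^-1 by rewrite invr_gt0.
have W0 := lie_box_nbhs p0.
pose v : 'rV[R]_n := const_mx 1.
pose t : 'rV[circle R]_d := const_mx (circle_pi p.+1%:R^-1).
have [k _ /(_ k (leqnn k))] := h (v, t, 0) _ W0.
rewrite /= lie_mulrnE /= => -[/= vk tk _].
have nv (i : 'I_n) : False.
  have := vk ord0 i; rewrite mulrn_mxE mxE normr_nat.
  by rewrite (ltr_nat _ _ 1) ltnS leqn0 expn_eq0 => /andP[/eqP p00]; rewrite p00 in pp.
have nt (i : 'I_d) : False.
  have [r /= rlt] := tk ord0 i.
  rewrite mulrn_mxE mxE -circle_piMn => /circle_pi_eq /intrP[m rm].
  (* The radius 1/(p+1) is chosen so that (p+1)r, an integer, has absolute value below 1 and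
     vanishes; then p+1 would divide a power of p. *)
  have rE : p.+1%:R * r = ((p.+1%:Z * m + (p ^ k)%N%:Z)%:~R : R).
    rewrite intrD intrM -rm mulrBr -[_ *+ (p ^ k)]mulr_natr mulrA mulfV ?pnatr_eq0//.
    by rewrite mul1r subrK.
  have : `|p.+1%:R * r| < 1.
    by rewrite normrM normr_nat -ltr_pdivlMl// mulr1.
  rewrite rE => /(int_small (intr_int _ _)) /eqP; rewrite intr_eq0 => /eqP.
  move=> /eqP; rewrite addrC addr_eq0 -mulrN => /eqP E.
  have : (p.+1 %| p ^ k)%N.
    by rewrite -[(_ %| _)%N]/(p.+1%:Z %| (p ^ k)%N%:Z)%Z E dvdz_mulr.
  move=> /gcdn_idPl; have : coprime p.+1 (p ^ k) by rewrite coprimeXr ?coprimeSn.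
  by rewrite /coprime => /eqP -> [p00]; rewrite -p00 in pp.
have xE (x : L) : x.1 = 0.
  case: x => -[a b] c /=; congr (_, _); apply/matrixP => i j; first by case: (nv j).
  by case: (nt j).
apply: filterS W0 => -[x y] [_ _ /= ->].
by have /= -> := xE (x, y).
Qed.

End no_small_subgroups.

(** Some [U k] has its image inside the small box; this image is a subgroup, so it is closed under
    doubling and must be trivial. *)
Lemma lie_quotient_contains (R : realType) (G : topologicalZmodType)
    (U : nat -> zmodClosed G) (bU : nonarch_basis U) (M : zmodClosed G) :
  lie_quotient R M -> exists n, forall x, x \in U n -> x \in M.
Proof.
move=> [_ [_ [n [d [D [_ oD [f [g [fg _ cf _]]]]]]]]].
have q0 : 0 < (4^-1 : R) by rewrite invr_gt0.
have W0 := lie_box_nbhs (R := R) n d oD q0.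
have [_ _ /(_ ((f \o tquot_pi M) @^-1` lie_box 4^-1))[]] := bU.
  have : nbhs (tquot_pi M 0) (f @^-1` lie_box 4^-1).
    rewrite raddf0; apply: cf; rewrite raddf0; exact: W0.
  exact: tquot_pi_continuous.
move=> k kW; exists k => x xk.
have fx0 : f (tquot_pi M x) = 0.
  apply: lie_no_small_subgroups => j; rewrite -!raddfMn.
  by apply: kW => /=; exact: rpredMn.
have : tquot_pi M x = tquot_pi M 0.
  by rewrite raddf0 -[LHS]fg fx0 -(raddf0 f) fg.
by move/tquot_pi_eq; rewrite subr0.
Qed.

Theorem nonarch_pro_p (R : realType) (p : nat) (G : topologicalZmodType)
    (U : nat -> zmodClosed G) :
  nonarch_polish U -> nonarch_ptorsion U p -> pro_p R p G.
Proof.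
move=> [bU _ _ [s sP]] tU; have [dU nU sU] := bU; split.
  move=> A /sU[n nA]; exists (U n) => //.
  exact: (@lie_quotient_open _ _ _ (nU n) s (sP n)).
move=> M /(lie_quotient_contains bU)[n nM]; exists (U n); split.
- exact: (@lie_quotient_open _ _ _ (nU n) s (sP n)).
- by move=> x; exact: nM.
- exact: (tquot_topological_p_group R (nU n) (sP n)).
Qed.

Section pab_structure.
Context (R : realType) (p : nat).

(** The convergence of [x *+ (p ^ k)] to 0 is transported to the Lie model, which is therefore
    discrete. In a discrete group, convergence to 0 means being 0 eventually. *)
Lemma topological_p_group_open (G : topologicalZmodType) (N : zmodClosed G) :
  prime p -> lie_quotient R N -> topological_p_group R p (tquot N) ->
  nbhs 0 [set` N] /\ forall x, exists k, x *+ (p ^ k)%N \in N.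
Proof.
move=> pp [_ [_ [n [d [D [_ oD [f [g [fg gf cf cg]]]]]]]]] [_ _ pG].
have d0 : nbhs (0 : tquot N) [set 0].
  have : nbhs (0 : 'rV[R]_n * 'rV[circle R]_d * D) [set 0].
    apply: (lie_p_group_discrete oD pp) => x A nA.
    have nfA : nbhs (0 : tquot N) (f @^-1` A) by apply: cf; rewrite raddf0.
    have : \forall k \near \oo, A (f (g x *+ (p ^ k)%N)) := pG (g x) _ nfA.
    suff : (\forall k \near \oo, A (f (g x *+ (p ^ k)%N))) ->
      \forall k \near \oo, A (x *+ (p ^ k)%N) by [].
    by apply: filterS => k; rewrite raddfMn gf.
  move=> h0; have : nbhs (0 : tquot N) (f @^-1` [set 0]) by apply: cf; rewrite raddf0.
  apply: filterS => x /= fx; by rewrite -[x]fg fx -(raddf0 f) fg.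
have nN : nbhs (0 : G) (tquot_pi N @^-1` [set 0]).
  by apply: tquot_pi_continuous; rewrite raddf0.
split.
  apply: filterS nN => x /=.
  by rewrite -(raddf0 (@tquot_pi G N)) => /tquot_pi_eq; rewrite subr0.
move=> x; have [k _ /(_ k (leqnn k)) /= ] := pG (tquot_pi N x) _ d0.
exists k; rewrite -[_ *+ _]subr0; apply/tquot_pi_eq; by rewrite raddfMn raddf0.
Qed.

End pab_structure.

(** * Completeness and the structure of pro-p Polish groups *)

Section completeness.
Context (R : realType) (G : topologicalZmodType) (U : nat -> zmodClosed G).
Hypothesis bU : nonarch_basis U.

Lemma nonarch_cauchy (x : nat -> G) : (forall n, x n.+1 - x n \in U n) ->
  forall m n, (m <= n)%N -> x n - x m \in U m.
Proof.
move=> xU m n /subnK <-; elim: (n - m)%N => [|k IH]; first by rewrite subrr rpred0.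
rewrite -(subrKA (x (k + m)%N)) rpredD//.
by apply: (nonarch_anti bU _ (xU _)); rewrite leq_addl.
Qed.

(* The metric need not be translation invariant, so a sequence [x] that is
   Cauchy for [U] need not be Cauchy for the metric. One builds [c] with
   [c k + c k.+1] a subsequence of [x] and such that both the even and the odd
   terms of [c] are Cauchy for both structures. *)
Lemma completely_metrizable_nonarch_complete :
  completely_metrizable R G -> nonarch_complete U.
Proof.
move=> [M [f [g [fg gf cf cg complM]]]] x xU.
have xC := nonarch_cauchy xU.
(* [N (a, k)] is a level whose coset around [a] lies in the ball of radius 1/(k+1). Keeping [n k]
   above [N (c k, k)] traps all later terms of the same parity in that ball. *)
have [N NP] : {N : G * nat -> nat & forall ak : G * nat, forall y,
    y - ak.1 \in U (N ak) -> ball (f ak.1) (ak.2.+1%:R^-1 : R) (f y)}.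
  apply: (choice (P := fun (ak : G * nat) n => forall y,
    y - ak.1 \in U n -> ball (f ak.1) (ak.2.+1%:R^-1 : R) (f y))) => -[a k] /=.
  apply/(nbhs_nonarch bU a); apply: cf.
  by apply: nbhsx_ballx; rewrite invr_gt0.
pose st := fix st (k : nat) : G * nat :=
  if k is k'.+1 then
    let c := x (st k').2 - (st k').1 in (c, maxn (st k').2.+1 (N (c, k)))
  else (0, N (0, 0%N)).
pose c k := (st k).1; pose n k := (st k).2.
have cS k : c k.+1 = x (n k) - c k by [].
have nS k : (n k < n k.+1)%N by rewrite /n /= leq_maxl.
have nN k : (N (c k, k) <= n k)%N by case: k => [|k] //; rewrite /n /= leq_maxr.
have nmono i j : (i <= j)%N -> (n i <= n j)%N.
  move=> /subnK <-; elim: (j - i)%N => // k IH.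
  exact: leq_trans IH (ltnW (nS _)).
have nge k : (k <= n k)%N by elim: k => // k IH; exact: leq_ltn_trans IH (nS k).
have c2 k j : c (k + j.*2)%N - c k \in U (n k).
  elim: j => [|j IH]; first by rewrite addn0 subrr rpred0.
  rewrite doubleS !addnS -(subrKA (c (k + j.*2)%N)) rpredD// !cS.
  rewrite opprB addrA addrAC addrK.
  apply: nonarch_anti bU _ _ _ _ (xC _ _ (ltnW (nS _))).
  by apply: nmono; rewrite leq_addr.
have lim r : exists a, forall m, \forall j \near \oo, c (r + j.*2)%N - a \in U m.
  pose F := (fun j => f (c (r + j.*2)%N)) @ \oo.
  have [|l lF] := complM F _.
    apply: cauchy_exP => e e0.
    have [k _ /(_ k (leqnn k)) /= ke] := near_infty_natSinv_lt (PosNum e0).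
    exists (f (c (r + k.*2)%N)); exists k => // j /= kj.
    apply: (@le_ball _ _ _ ((r + k.*2)%N.+1%:R^-1)).
      apply: le_trans (ltW ke); rewrite lef_pV2 ?posrE// ler_nat ltnS.
      by rewrite -addnn addnA leq_addl.
    apply: (NP (c (r + k.*2)%N, (r + k.*2)%N)).
    rewrite -(subnKC kj) doubleD addnA.
    exact: (nonarch_anti bU (nN (r + k.*2)%N) (c2 (r + k.*2)%N _)).
  exists (g l) => m.
  have : nbhs (g l) [set y | y - g l \in U m].
    by apply/(nbhs_nonarch bU); exists m.
  move=> /cg /lF; suff h : (\forall j \near \oo, g (f (c (r + j.*2)%N)) - g l \in U m)
    -> \forall j \near \oo, c (r + j.*2)%N - g l \in U m by exact: h.
  by apply: filterS => j; rewrite fg.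
have [a aP] := lim 0%N; have [b bP] := lim 1%N.
exists (a + b) => m.
have [j [[aj bj] mj]] := filter_ex (filterI (filterI (aP m) (bP m)) (nbhs_infty_ge m)).
rewrite -(subrKA (x (n j.*2))) rpredD//.
  rewrite -opprB rpredN.
  have <- : c (0 + j.*2)%N + c (1 + j.*2)%N = x (n j.*2).
    by rewrite add0n add1n cS addrC subrK.
  by rewrite opprD addrACA rpredD.
apply: xC; apply: leq_trans mj _; apply: leq_trans (nge _).
by rewrite -addnn leq_addr.
Qed.

End completeness.

(** Every metric ball at 0 contains a subgroup with Lie quotient, hence a smaller one whose quotient
    is a p-group, which is open. Finite intersections make the sequence decreasing, and torsion
    survives them because exponents can be added. *)
Theorem pab_nonarch (R : realType) (p : nat) (G : pab R p) : prime p ->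
  exists U : nat -> zmodClosed G, nonarch_polish U /\ nonarch_ptorsion U p.
Proof.
move=> pp; have [[D cD dD] mG] := pab_polish G; have [plG ppG] := pab_pro_p G.
have [M [f [g [fg gf cf cg complM]]]] := mG.
have [N NP] : {N : nat -> zmodClosed G & forall k,
    [/\ nbhs 0 [set` N k], forall x, exists j, x *+ (p ^ j)%N \in N k &
        forall x, x \in N k -> ball (f 0) (k.+1%:R^-1 : R) (f x)]}.
  apply: (choice (P := fun k (V : zmodClosed G) => [/\ nbhs 0 [set` V],
      forall x, exists j, x *+ (p ^ j)%N \in V &
        forall x, x \in V -> ball (f 0) (k.+1%:R^-1 : R) (f x)])) => k.
  have /plG[V lV VB] : nbhs 0 (f @^-1` ball (f 0) (k.+1%:R^-1 : R)).
    by apply: cf; apply: nbhsx_ballx; rewrite invr_gt0.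
  have [W [lW WV pW]] := ppG _ lV.
  have [nW tW] := topological_p_group_open pp lW pW.
  by exists W; split=> // x xW; apply: VB; exact: WV.
have S0 n : [set x | forall k, (k <= n)%N -> x \in N k] 0 by move=> k _; exact: rpred0.
have SB n x y : [set x | forall k, (k <= n)%N -> x \in N k] x ->
    [set x | forall k, (k <= n)%N -> x \in N k] y ->
    [set x | forall k, (k <= n)%N -> x \in N k] (x - y).
  by move=> hx hy k kn; apply: rpredB; [exact: hx|exact: hy].
have [U UE] : exists U : nat -> zmodClosed G, forall n x,
    x \in U n <-> forall k, (k <= n)%N -> x \in N k.
  by exists (fun n => subgroup_of_set (S0 n) (@SB n)) => n x;
    exact: in_subgroup_of_set.
have US n x : x \in U n -> x \in N n.+1 -> x \in U n.+1.
  move=> /UE xn xN; apply/UE => k; rewrite leq_eqVlt => /predU1P[->//|].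
  by rewrite ltnS; exact: xn.
have nU n : nbhs 0 [set` U n].
  elim: n => [|n IH].
    have [n0 _ _] := NP 0%N; apply: filterS n0 => x xN; apply/UE => k.
    by rewrite leqn0 => /eqP ->.
  have [n1 _ _] := NP n.+1; apply: filterS (filterI IH n1) => x [] /=.
  exact: US.
have bU : nonarch_basis U.
  split=> // [n x /UE xn|A nA]; first by apply/UE => k kn; apply: xn; exact: leqW.
  have : nbhs (f 0) (g @^-1` A) by apply: cg; rewrite fg.
  rewrite -nbhs_ballE => -[e /= e0 eA].
  have [k _ /(_ k (leqnn k)) /= ke] := near_infty_natSinv_lt (PosNum e0).
  exists k => x /= /UE /(_ k (leqnn k)) xk; rewrite -[x]fg; apply: eA.
  by apply: (le_ball (ltW ke)); have [_ _] := NP k; exact.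
exists U; split.
  split=> //.
  - move=> x xU; rewrite -[x]fg -[0]fg; congr g; apply/esym.
    apply: mdist_positivity; apply/eqP; rewrite eq_le mdist_ge0 andbT leNgt.
    apply/negP => e0.
    have [k _ /(_ k (leqnn k)) /= ke] := near_infty_natSinv_lt (PosNum e0).
    have [_ _ /(_ x)] := NP k; have /UE/(_ k (leqnn k)) xk := xU k.
    by move=> /(_ xk); rewrite ballEmdist /= ltNge (ltW ke).
  - exact: completely_metrizable_nonarch_complete mG.
  - have /countable_injP[h hinj] := cD.
    exists (fun n => xget 0 [set y | D y /\ h y = n]) => n x.
    have [y [/= Uy Dy]] : [set y | y - x \in U n] `&` D !=set0.
      apply: dD; first by exists x; rewrite /= subrr rpred0.
      rewrite openE => y /= yx; apply/nbhs_translate.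
      by apply: filterS (nU n) => z /= Uz; rewrite addrAC rpredD.
    exists (h y); case: xgetP => [z _ [Dz hz]|/(_ y)]; last by move=> [].
    have -> : z = y by apply: hinj => //; rewrite inE.
    by rewrite -opprB rpredN.
elim=> [|n IH] x.
  have [_ /(_ x)[j xj] _] := NP 0%N; exists j; apply/UE => k.
  by rewrite leqn0 => /eqP ->.
have [_ /(_ x)[j xj] _] := NP n.+1; have [i xi] := IH x.
exists (i + j)%N; apply: US.
  by rewrite expnD mulrnA rpredMn.
by rewrite expnD mulnC mulrnA rpredMn.
Qed.

(** * Quotients, embeddings and products *)

Section filtered_group.
Context (G : zmodType) (V : nat -> zmodClosed G).
Hypothesis dV : forall n x, x \in V n.+1 -> x \in V n.

(** The proof argument is there to record [V] in the type, so that the topology can be attached to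
    it as a canonical instance. *)
Definition filtered of (forall n x, x \in V n.+1 -> x \in V n) : Type := G.
Local Notation FG := (filtered dV).

HB.instance Definition _ := GRing.Zmodule.on FG.

Definition filtered_nbhs (x : FG) : set_system FG :=
  [set A | exists n, forall y : G, y - (x : G) \in V n -> A y].

HB.instance Definition _ := hasNbhs.Build FG filtered_nbhs.

Let antiV m n x : (m <= n)%N -> x \in V n -> x \in V m.
Proof. by move=> /subnK <-; elim: (n - m)%N => // k IH /dV; exact: IH. Qed.

Let nbhs_pfilter (x : FG) : ProperFilter (nbhs x).
Proof.
apply: Build_ProperFilter_ex.
  by move=> A [n nA]; exists x; apply: nA; rewrite subrr rpred0.
split; first by exists 0%N.
  move=> A B [m mA] [n nB]; exists (maxn m n) => y yx.
  by split; [apply: mA|apply: nB]; apply: antiV yx; rewrite ?leq_maxl ?leq_maxr.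
by move=> A B AB [n nA]; exists n => y /nA; exact: AB.
Qed.

Let nbhs_singleton (x : FG) (A : set FG) : nbhs x A -> A x.
Proof. by move=> [n nA]; apply: nA; rewrite subrr rpred0. Qed.

Let nbhs_nbhs (x : FG) (A : set FG) : nbhs x A -> nbhs x (nbhs^~ A).
Proof.
move=> [n nA]; exists n => y yx; exists n => z zy; apply: nA.
by rewrite -(subrKA y) rpredD.
Qed.

HB.instance Definition _ := Nbhs_isNbhsTopological.Build FG
  nbhs_pfilter nbhs_singleton nbhs_nbhs.

Let sub_continuous : continuous (fun z : FG * FG => z.1 - z.2).
Proof.
move=> [a b] A [n nA].
exists ([set y : FG | (y : G) - a \in V n], [set y : FG | (y : G) - b \in V n]).
  by split; exists n.
move=> [y z] [/= ya zb]; apply: nA.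
have -> : ((y : G) - z) - ((a : G) - b) = (y - a) - (z - b).
  by rewrite !opprB addrACA [in RHS]addrACA; congr (_ + _); rewrite addrC.
exact: rpredB.
Qed.

HB.instance Definition _ :=
  PreTopologicalNmodule_isTopologicalZmodule.Build FG sub_continuous.

Let filtered0 n : [set x : FG | (x : G) \in V n] 0.
Proof. exact: rpred0. Qed.

Let filteredB n (x y : FG) : [set x : FG | (x : G) \in V n] x ->
  [set x : FG | (x : G) \in V n] y -> [set x : FG | (x : G) \in V n] (x - y).
Proof. exact: rpredB. Qed.

Definition filtered_subgroup (n : nat) : zmodClosed FG :=
  subgroup_of_set (@filtered0 n) (@filteredB n).

Lemma in_filtered_subgroup n (x : FG) :
  (x \in filtered_subgroup n) <-> (x : G) \in V n.
Proof. exact: in_subgroup_of_set. Qed.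

Lemma filtered_basis : nonarch_basis filtered_subgroup.
Proof.
split=> [n x /in_filtered_subgroup/dV ?|n|A [n nA]].
- exact/in_filtered_subgroup.
- by exists n => y; rewrite subr0 => ?; apply/in_filtered_subgroup.
- by exists n => y /= /in_filtered_subgroup yn; apply: nA; rewrite subr0.
Qed.

End filtered_group.

Section quotient.
Context (G : topologicalZmodType) (U : nat -> zmodClosed G) (C : zmodClosed G).
Hypothesis pU : nonarch_polish U.
Hypothesis clC : closed [set` C].

Let image0 n : [set y | exists2 x, x \in U n & tquot_pi C x = y] 0.
Proof. by exists 0; rewrite ?rpred0// raddf0. Qed.

Let imageB n x y : [set y | exists2 x, x \in U n & tquot_pi C x = y] x ->
  [set y | exists2 x, x \in U n & tquot_pi C x = y] y ->
  [set y | exists2 x, x \in U n & tquot_pi C x = y] (x - y).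
Proof.
by move=> [a aU <-] [b bU <-]; exists (a - b); rewrite ?rpredB// raddfB.
Qed.

Definition tquot_filtration n : zmodClosed (tquot C) :=
  subgroup_of_set (@image0 n) (@imageB n).

Lemma in_tquot_filtration n y :
  (y \in tquot_filtration n) <-> exists2 x, x \in U n & tquot_pi C x = y.
Proof. exact: in_subgroup_of_set. Qed.

Lemma tquot_nonarch_basis : nonarch_basis tquot_filtration.
Proof.
have [[dU nU sU] _ _ _] := pU; split.
- move=> n y /in_tquot_filtration[x /dU xU <-].
  by apply/in_tquot_filtration; exists x.
- move=> n; have := tquot_pi_nbhs C (nU n); rewrite raddf0; apply: filterS.
  by move=> _ [x /= xU <-]; apply/in_tquot_filtration; exists x.
- move=> A nA; have [|n nUA] := sU (tquot_pi C @^-1` A).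
    by apply: tquot_pi_continuous; rewrite raddf0.
  by exists n => y /= /in_tquot_filtration[x xU <-]; exact: nUA.
Qed.

Lemma tquot_nonarch_polish : nonarch_polish tquot_filtration.
Proof.
have [bU sepU compU [s sP]] := pU; split.
- exact: tquot_nonarch_basis.
- move=> y; have [x <-] := tquot_pi_surj y => xU.
  rewrite -(raddf0 (@tquot_pi G C)); apply/tquot_pi_eq; rewrite subr0.
  apply: clC => A /(nbhs_nonarch bU)[n nA].
  have /in_tquot_filtration[u uU /tquot_pi_eq uC] := xU n.
  exists (x - u); split; first by rewrite /= -opprB rpredN.
  by apply: nA; rewrite addrAC subrr add0r rpredN.
- move=> y yU.
  (* The differences are lifted and summed; independent lifts of the terms would not form a Cauchy
     sequence. *)
  have ex n : exists u, u \in U n /\ tquot_pi C u = y n.+1 - y n.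
    by have /in_tquot_filtration[u uU uE] := yU n; exists u.
  have [u uP] := choice ex; have [x0 x0E] := tquot_pi_surj (y 0%N).
  pose x := fix x n := if n is n'.+1 then x n' + u n' else x0.
  have xE n : tquot_pi C (x n) = y n.
    elim: n => [//|n IH]; have [_ uE] := uP n.
    have -> : x n.+1 = x n + u n by [].
    have -> : tquot_pi C (x n + u n) = tquot_pi C (x n) + tquot_pi C (u n).
      exact: raddfD.
    by rewrite IH uE addrC subrK.
  have [|l lP] := compU x.
    by move=> n; rewrite /= addrAC subrr add0r; have [] := uP n.
  exists (tquot_pi C l) => n; apply/in_tquot_filtration.
  by exists (l - x n) => //; rewrite -[y n]xE; exact: raddfB.
- exists (tquot_pi C \o s) => n y; have [x <-] := tquot_pi_surj y.
  have [i xi] := sP n x; exists i; apply/in_tquot_filtration.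
  by exists (x - s i); rewrite ?raddfB.
Qed.

Lemma tquot_pdivisible p : nonarch_pdivisible U p ->
  nonarch_pdivisible tquot_filtration p.
Proof.
move=> dvU n _ /in_tquot_filtration[x xU <-].
have [y yU <-] := dvU _ _ xU; exists (tquot_pi C y); last by rewrite raddfMn.
by apply/in_tquot_filtration; exists y.
Qed.

Lemma tquot_ptorsion p : nonarch_ptorsion U p ->
  nonarch_ptorsion tquot_filtration p.
Proof.
move=> tU n y; have [x <-] := tquot_pi_surj y; have [k xk] := tU n x.
by exists k; apply/in_tquot_filtration; exists (x *+ (p ^ k)%N); rewrite ?raddfMn.
Qed.

End quotient.

Section embedding.
Context (A B : topologicalZmodType) (f : {additive A -> B}).
Context (U : nat -> zmodClosed A) (W : nat -> zmodClosed B).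
Hypothesis pU : nonarch_polish U.
Hypothesis bW : nonarch_basis W.
Hypothesis sepW : nonarch_separated W.
Hypothesis fU : forall n a, a \in U n -> f a \in W n.
Hypothesis fW : forall n a, f a \in W n.+1 -> a \in U n.

Lemma nonarch_continuous : continuous f.
Proof.
apply: additive_continuous0 => D nD; have [[_ nU _] _ _ _] := pU.
have [_ _ /(_ _ nD)[n nWD]] := bW.
by apply: filterS (nU n) => a /= /fU; exact: nWD.
Qed.

Lemma nonarch_injective : injective f.
Proof.
have [_ sepU _ _] := pU.
move=> a b fab; apply/eqP; rewrite -subr_eq0; apply/eqP; apply: sepU => n.
by apply: fW; rewrite raddfB fab subrr rpred0.
Qed.

(** Approximating a limit point to within [W n.+1] gives preimages that [fW] makes Cauchy, so
    completeness of [A] supplies a preimage of the point itself. *)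
Lemma nonarch_closed_range : closed (range f).
Proof.
have [bU _ compU _] := pU; move=> y yf.
have ex n : exists a, y - f a \in W n.+1.
  have : nbhs y [set z | z - y \in W n.+1] by apply/(nbhs_nonarch bW); exists n.+1.
  move=> /yf[_ [[a _ <-] /= h]]; exists a; by rewrite -opprB rpredN.
have [a aP] := choice ex.
have [|l lP] := compU a.
  move=> n; apply: fW; rewrite raddfB -(subrKA y) rpredD//.
    by rewrite -opprB rpredN; have [dW _ _] := bW; exact: dW.
exists l => //; apply/eqP; rewrite -subr_eq0; apply/eqP; apply: sepW => n.
rewrite -(subrKA (f (a n))) rpredD// -?raddfB ?fU//.
by rewrite -opprB rpredN; have [dW _ _] := bW; exact: dW.
Qed.

Lemma nonarch_open_range (D : set A) : open D ->
  exists2 V : set B, open V & f @` D = V `&` range f.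
Proof.
have [bU _ _ _] := pU; move=> oD.
exists [set y | exists a n, (forall a', a' - a \in U n -> D a') /\ y - f a \in W n.+1].
  rewrite openE => y [a [n [aD ya]]]; apply/(nbhs_nonarch bW).
  exists n.+1 => z zy; exists a, n; split=> //.
  by rewrite -(subrKA y) rpredD.
apply/seteqP; split.
  move=> _ [a Da <-]; split; last by exists a.
  have : nbhs a D by rewrite openE in oD; exact: oD.
  move=> /(nbhs_nonarch bU)[n nD]; exists a, n; split=> //.
  by rewrite subrr rpred0.
move=> y [[a [n [aD fya]]] [b _ E]]; exists b => //; apply: aD.
by apply: fW; rewrite raddfB E.
Qed.

End embedding.

Section product.
Context (G H : topologicalZmodType).
Context (U : nat -> zmodClosed G) (V : nat -> zmodClosed H).
Hypotheses (pU : nonarch_polish U) (pV : nonarch_polish V).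

Let pair0 n : [set z : G * H | z.1 \in U n /\ z.2 \in V n] 0.
Proof. by split; exact: rpred0. Qed.

Let pairB n (x y : G * H) : [set z : G * H | z.1 \in U n /\ z.2 \in V n] x ->
  [set z : G * H | z.1 \in U n /\ z.2 \in V n] y ->
  [set z : G * H | z.1 \in U n /\ z.2 \in V n] (x - y).
Proof. by move=> [? ?] [? ?]; split; exact: rpredB. Qed.

Definition pair_subgroup n : zmodClosed (G * H)%type :=
  subgroup_of_set (@pair0 n) (@pairB n).

Lemma in_pair_subgroup n z :
  (z \in pair_subgroup n) <-> z.1 \in U n /\ z.2 \in V n.
Proof. exact: in_subgroup_of_set. Qed.

Lemma pair_subgroup_decr n z :
  z \in pair_subgroup n.+1 -> z \in pair_subgroup n.
Proof.
have [[dU _ _] _ _ _] := pU; have [[dV _ _] _ _ _] := pV.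
by move=> /in_pair_subgroup[/dU ? /dV ?]; apply/in_pair_subgroup.
Qed.

Definition prodtop : topologicalZmodType := filtered pair_subgroup_decr.
Definition prod_filtration : nat -> zmodClosed prodtop :=
  filtered_subgroup pair_subgroup_decr.

Lemma in_prod_filtration n (z : prodtop) :
  (z \in prod_filtration n) <-> z.1 \in U n /\ z.2 \in V n.
Proof.
by split=> [/in_filtered_subgroup/in_pair_subgroup//|?];
  apply/in_filtered_subgroup/in_pair_subgroup.
Qed.

Lemma prod_nonarch_polish : nonarch_polish prod_filtration.
Proof.
have [_ sepU compU [s sP]] := pU; have [_ sepV compV [t tP]] := pV; split.
- exact: filtered_basis.
- move=> [x y] h; congr (_, _).
    by apply: sepU => n; have /in_prod_filtration[] := h n.
  by apply: sepV => n; have /in_prod_filtration[] := h n.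
- move=> x xP.
  have [|l lP] := compU (fun n => (x n).1).
    by move=> n; have /in_prod_filtration[] := xP n.
  have [|m mP] := compV (fun n => (x n).2).
    by move=> n; have /in_prod_filtration[] := xP n.
  by exists (l, m) => n; apply/in_prod_filtration; split; [exact: lP|exact: mP].
- exists (fun i => if unpickle i is Some ij then (s ij.1, t ij.2) else 0).
  move=> n [x y]; have [i xi] := sP n x; have [j yj] := tP n y.
  by exists (pickle (i, j)); rewrite pickleK; apply/in_prod_filtration.
Qed.

Lemma prod_ptorsion p : nonarch_ptorsion U p -> nonarch_ptorsion V p ->
  nonarch_ptorsion prod_filtration p.
Proof.
move=> tU tV n [x y]; have [i xi] := tU n x; have [j yj] := tV n y.
exists (i + j)%N; have -> : ((x, y) : prodtop) *+ (p ^ (i + j))%N =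
    (x *+ (p ^ (i + j))%N, y *+ (p ^ (i + j))%N).
  by elim: (p ^ _)%N => [|k IH] //; rewrite !mulrS IH.
apply/in_prod_filtration; rewrite /= expnD; split.
  by rewrite mulrnA rpredMn.
by rewrite mulnC mulrnA rpredMn.
Qed.

End product.

(** * Open mapping theorem *)

Section open_mapping.
Context (B C : topologicalZmodType) (f : {additive B -> C}).
Context (U : nat -> zmodClosed B) (V : nat -> zmodClosed C).
Hypotheses (pU : nonarch_polish U) (pV : nonarch_polish V).
Hypothesis cf : continuous f.
Hypothesis surjf : forall c, exists b, f b = c.

(* Baire: [C] is covered by countably many translates of the closure of
   [f @` U n]. If that closure contained no [V m], one could build a Cauchy
   sequence whose limit avoids all these translates. *)
Lemma image_closure_open n : exists m, forall c, c \in V m ->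
  forall k, exists2 u, u \in U n & c - f u \in V k.
Proof.
have [bU _ _ [s sP]] := pU; have [bV _ compV _] := pV; have [dV _ _] := bV.
apply: contrapT => hn.
have step (a : nat * (C * nat)) : exists y : C * nat,
    [/\ y.1 - a.2.1 \in V a.2.2, (a.2.2 < y.2)%N &
        forall u, u \in U n -> y.1 - f (s a.1) - f u \notin V y.2].
  case: a => j [x m] /=; apply: contrapT => hx; apply: hn; exists m => c cm k.
  (* If no coset inside [x + V m] avoids the translate, every point of [x + V m] is approximable.
     Subtracting the case [c' = 0] removes [x] and [s j]. *)
  have near0 c' : c' \in V m -> exists2 u, u \in U n & x + c' - f (s j) - f u \in V k.
    move=> c'm; apply: contrapT => hu; apply: hx.
    exists (x + c', maxn m.+1 k); split=> /=.
    - by rewrite addrAC subrr add0r.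
    - exact: leq_maxl.
    - move=> u uU; apply/negP => h; apply: hu; exists u => //.
      by apply: (nonarch_anti bV _ h); rewrite leq_maxr.
  have [u uU cu] := near0 c cm; have [w wU cw] := near0 0 (rpred0 _).
  exists (u - w); first exact: rpredB.
  have E z : c - (f u - f w) = z + (c - f u) - (z - f w).
    by rewrite !opprB [z + _]addrC addrACA subrr addr0 addrA addrAC.
  rewrite addr0 in cw.
  have cu' : x - f (s j) + (c - f u) \in V k by rewrite addrA (addrAC x).
  by rewrite raddfB (E (x - f (s j))) rpredB.
have [F FP] := choice step.
pose st := fix st j : C * nat := if j is j'.+1 then F (j', st j') else (0, 0%N).
pose x j := (st j).1; pose m j := (st j).2.
have xS j : x j.+1 - x j \in V (m j) by have [] := FP (j, st j).
have mS j : (m j < m j.+1)%N by have [] := FP (j, st j).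
have xN j u : u \in U n -> x j.+1 - f (s j) - f u \notin V (m j.+1).
  by have [_ _] := FP (j, st j); apply.
have mge j : (j <= m j)%N by elim: j => // j IH; exact: leq_ltn_trans IH (mS j).
have mmono i j : (i <= j)%N -> (m i <= m j)%N.
  move=> /subnK <-; elim: (j - i)%N => // k IH.
  exact: leq_trans IH (ltnW (mS _)).
have xC i j : (i <= j)%N -> x j - x i \in V (m i).
  move=> /subnK <-; elim: (j - i)%N => [|k IH]; first by rewrite subrr rpred0.
  rewrite -(subrKA (x (k + i)%N)) rpredD//.
  by apply: (nonarch_anti bV _ (xS _)); rewrite mmono// leq_addl.
have [|l lP] := compV x; first by move=> j; exact: (nonarch_anti bV (mge j) (xS j)).
have [b fb] := surjf l; have [j bj] := sP n b.
have /negP := xN j _ bj; apply.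
rewrite raddfB fb opprB addrA subrK.
pose i := maxn j.+1 (m j.+1).
rewrite -opprB rpredN -(subrKA (x i)) rpredD//.
  by apply: (nonarch_anti bV _ (lP i)); rewrite leq_maxr.
by apply: xC; rewrite leq_maxl.
Qed.

(** Successive approximation: the error at stage i is small enough to be approximated by the image
    of [U (n + i)], so the corrections add up to an element of [U n]. *)
Lemma open_mapping n : nbhs 0 (f @` [set` U n]).
Proof.
have [bU _ compU _] := pU; have [bV sepV _ _] := pV; have [_ nV _] := bV.
have [M MP] := choice image_closure_open.
apply: filterS (nV (M n)) => c /= cn.
(* The levels [M] need not grow; taking the maximum with [a.1] forces the errors to tend to 0. *)
have step (a : nat * C) : exists u, a.2 \in V (M (n + a.1)%N) ->
    u \in U (n + a.1)%N /\ a.2 - f u \in V (maxn (M (n + a.1).+1) a.1).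
  have [h|h] := pselect (a.2 \in V (M (n + a.1)%N)); last by exists 0.
  by have [u uU cu] := MP _ _ h (maxn (M (n + a.1).+1) a.1); exists u.
have [F FP] := choice step.
pose x := fix x i := if i is i'.+1 then x i' + F (i', c - f (x i')) else 0.
have xV i : c - f (x i) \in V (M (n + i)%N).
  elim: i => [|i IH]; first by rewrite /= raddf0 subr0 addn0.
  have [_] := FP (i, c - f (x i)) IH.
  rewrite -addrA -opprD -raddfD addnS => h.
  by apply: (nonarch_anti bV _ h); rewrite leq_maxl.
have xU i : x i.+1 - x i \in U (n + i)%N.
  by rewrite /= addrAC subrr add0r; have [] := FP (i, c - f (x i)) (xV i).
have xV' i : c - f (x i.+1) \in V i.
  have [_] := FP (i, c - f (x i)) (xV i).
  rewrite -addrA -opprD -raddfD => h.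
  by apply: (nonarch_anti bV _ h); rewrite leq_maxr.
have xn i : x i \in U n.
  elim: i => [|i IH]; first exact: rpred0.
  rewrite -(subrK (x i) (x i.+1)) rpredD//.
  by apply: (nonarch_anti bU _ (xU i)); rewrite leq_addr.
have [|l lP] := compU x.
  by move=> i; apply: (nonarch_anti bU _ (xU i)); rewrite leq_addl.
exists l; first by rewrite /= -(subrK (x n) l) rpredD.
apply/eqP; rewrite -subr_eq0 -oppr_eq0 opprB; apply/eqP; apply: sepV => k.
have : nbhs (0 : B) (f @^-1` [set` V k]) by apply: cf; rewrite raddf0; exact: nV.
move=> /(nbhs_nonarch bU)[j jP].
pose i := (maxn j k).+1.
rewrite -(subrKA (f (x i))) rpredD//.
  by apply: (nonarch_anti bV _ (xV' _)); rewrite leq_maxr.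
rewrite -opprB rpredN -raddfB; apply: jP; rewrite subr0.
by apply: (nonarch_anti bU _ (lP i)); rewrite leqW// leq_maxl.
Qed.

End open_mapping.

(** * Extension of homomorphisms *)

Section extension.
Context (p : nat) (p_prime : prime p).
Context (B I : topologicalZmodType).
Context (O : nat -> zmodClosed B) (W : nat -> zmodClosed I).
Hypothesis dO : forall n x, x \in O n.+1 -> x \in O n.
Hypothesis tO : nonarch_ptorsion O p.
Hypothesis pW : nonarch_polish W.
Hypothesis W0 : forall x, x \in W 0%N.
Hypothesis dvW : nonarch_pdivisible W p.

(* Graphs of homomorphisms from a subgroup of [B] to [I] mapping [O n] to
   [W n]; being single-valued is a consequence of the last clause. *)
Definition bounded_graph (X : set (B * I)) :=
  [/\ X 0, forall u v, X u -> X v -> X (u - v) &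
      forall n u, X u -> u.1 \in O n -> u.2 \in W n].

Lemma bounded_graphD X u v : bounded_graph X -> X u -> X v -> X (u + v).
Proof.
move=> [X0 XB _] Xu Xv; rewrite -[v]opprK; apply: (XB _ _ Xu).
by rewrite -sub0r; exact: XB.
Qed.

Lemma bounded_graphMz X u k : bounded_graph X -> X u -> X (u *~ k).
Proof.
move=> gX Xu; have [X0 XB _] := gX.
have Xn n : X (u *+ n).
  by elim: n => [|n IH]; rewrite ?mulr0n// mulrS; exact: bounded_graphD.
case: k => n; first exact: Xn.
by rewrite NegzE mulrNz -sub0r; exact: XB (Xn _).
Qed.

Lemma mulrz_fst (u : B * I) k : (u *~ k).1 = u.1 *~ k.
Proof. by rewrite (raddfMz (@fst B I)). Qed.

Lemma mulrz_snd (u : B * I) k : (u *~ k).2 = u.2 *~ k.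
Proof. by rewrite (raddfMz (@snd B I)). Qed.

(** The level-n part of the condition that [X] together with the multiples of [(b, y)] generates a
    bounded graph. *)
Definition admissible (X : set (B * I)) (b : B) (n : nat) (y : I) :=
  forall u k, X u -> u.1 + b *~ k \in O n -> u.2 + y *~ k \in W n.

(** Take the least power p^i for which p^i b lies in the domain of [X] modulo [O n.+1], witnessed by
    [v]. By admissibility at level n, the defect of [y] against [v] is in [W n], so dividing it by
    p^i inside [W n] yields a correction that makes the defect 0. Any other constraint is a multiple
    of this one plus an element of [X] over [O n.+1], which is already bounded. *)
Lemma admissible_step X b n y : bounded_graph X -> admissible X b n y ->
  exists2 z, z - y \in W n & admissible X b n.+1 z.
Proof.
move=> gX Pn; have [X0 XB XO] := gX.
have ex : exists i, `[< exists2 u, X u & u.1 + b *~ (p ^ i)%N \in O n.+1 >].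
  have [k bk] := tO n.+1 b; exists k; apply/asboolP; exists 0 => //.
  by rewrite add0r.
have [i /asboolP[v Xv vO] imin] := ex_minnP ex.
have vy : v.2 + y *~ (p ^ i)%N \in W n by apply: Pn => //; exact: dO.
have dvi : forall j c, c \in W n -> exists2 d, d \in W n & d *+ (p ^ j)%N = c.
  elim=> [|j IH] c cW; first by exists c.
  have [d dW <-] := IH c cW; have [e eW <-] := dvW dW.
  by exists e => //; rewrite expnS mulrnA.
have [c cW cE] : exists2 d, d \in W n & d *+ (p ^ i)%N = - (v.2 + y *~ (p ^ i)%N).
  by apply: dvi; rewrite rpredN.
exists (y + c); first by rewrite addrAC subrr add0r.
have vz : v.2 + (y + c) *~ (p ^ i)%N = 0.
  by rewrite mulrzDl [c *~ _]cE addrA subrr.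
move=> u k Xu uO.
(* The gcd of [k] and p^i is a power p^j, and Bezout produces a witness for p^j too; minimality
   gives i <= j. *)
have /dvdzP[q kq] : ((p ^ i)%N %| k)%Z.
  have [a [a' aE]] := Bezoutz k (p ^ i)%N.
  have /(dvdn_pfactor _ _ p_prime)[j ji gE] := dvdn_gcdr `|k| (p ^ i).
  suff ij : (i <= j)%N.
    apply: dvdz_trans (dvdz_gcdl k (p ^ i)%N).
    by rewrite dvdzE [absz (gcdz _ _)]gE dvdn_exp2l.
  apply: imin; apply/asboolP; exists (u *~ a + v *~ a').
    by apply: bounded_graphD => //; exact: bounded_graphMz.
  have -> : (p ^ j)%N = a * k + a' * (p ^ i)%N :> int by rewrite aE -gE.
  have -> : (u *~ a + v *~ a').1 + b *~ (a * k + a' * (p ^ i)%N) =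
      (u.1 + b *~ k) *~ a + (v.1 + b *~ (p ^ i)%N) *~ a'.
    rewrite /= !mulrz_fst mulrzDr ![_ * Posz _]mulrC ![a * _]mulrC !mulrzA.
    by rewrite addrACA -!mulrzDl.
  by rewrite rpredD ?rpredMz.
have Xuv : X (u - v *~ q) by apply: XB => //; exact: bounded_graphMz.
have : (u - v *~ q).1 \in O n.+1.
  have -> : (u - v *~ q).1 = (u.1 + b *~ k) - (v.1 + b *~ (p ^ i)%N) *~ q.
    by rewrite /= mulrz_fst mulrzDl -mulrzA [_ * q]mulrC -kq opprD addrACA subrr addr0.
  by rewrite rpredB// rpredMz.
move=> /(XO _ _ Xuv).
suff -> : u.2 + (y + c) *~ k = (u - v *~ q).2 by [].
rewrite /= mulrz_snd kq [q * _]mulrC mulrzA.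
apply/eqP; rewrite -subr_eq0 opprD opprK addrACA subrr add0r -mulrzDl.
by rewrite [X in X *~ _]addrC vz mul0rz.
Qed.

Lemma admissible_exists X b : bounded_graph X ->
  exists y, forall n, admissible X b n y.
Proof.
move=> gX.
have step (a : nat * I) : exists z, admissible X b a.1 a.2 ->
    z - a.2 \in W a.1 /\ admissible X b a.1.+1 z.
  have [h|h] := pselect (admissible X b a.1 a.2); last by exists 0.
  by have [z zW zP] := admissible_step gX h; exists z.
have [F FP] := choice step.
pose y := fix y n := if n is n'.+1 then F (n', y n') else 0.
have yP n : admissible X b n (y n).
  (* Level 0 imposes no constraint because [W 0] is all of [I]; this lets the sequence start at an
     arbitrary value. *)
  elim: n => [|n IH]; first by move=> u k _ _; exact: W0.
  by have [] := FP (n, y n) IH.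
have [_ _ compW _] := pW.
have [|l lP] := compW y; first by move=> n; have [] := FP (n, y n) (yP n).
exists l => n u k Xu uO.
have -> : u.2 + l *~ k = (u.2 + y n *~ k) + (l - y n) *~ k.
  by rewrite mulrzBl -addrA; congr (_ + _); rewrite addrC subrK.
by rewrite rpredD ?rpredMz//; exact: yP.
Qed.

Lemma bounded_graph_adjoin X b y : bounded_graph X ->
  (forall n, admissible X b n y) ->
  exists X', [/\ bounded_graph X', X `<=` X' & X' (b, y)].
Proof.
move=> gX yP; have [X0 XB XO] := gX.
exists [set w | exists u k, X u /\ w = u + (b, y) *~ k]; split.
- split.
  + by exists 0, 0; rewrite mulr0z addr0.
  + move=> _ _ [u [k [Xu ->]]] [v [l [Xv ->]]]; exists (u - v), (k - l).
    by split; [exact: XB|rewrite mulrzBr opprD addrACA].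
  + move=> n _ [u [k [Xu ->]]]; rewrite [X in X \in O n]/= [X in X \in W n]/=.
    by rewrite mulrz_fst mulrz_snd; exact: yP.
- by move=> u Xu; exists u, 0; rewrite mulr0z addr0.
- by exists 0, 1; rewrite mulr1z add0r.
Qed.

Lemma bounded_graph_total X : bounded_graph X ->
  exists Y, [/\ bounded_graph Y, X `<=` Y & forall b, exists y, Y (b, y)].
Proof.
move=> gX.
(* Zorn is applied to what is added to [X], so that the empty chain, whose union is empty, causes no
   exception. *)
have [] := @Zorn_bigcup _ [set Z | bounded_graph (X `|` Z)].
  move=> F FP Ftot; have [X0 XB XO] := gX; rewrite /=.
  have FB Z u v : F Z -> (X `|` Z) u -> (X `|` Z) v ->
      (X `|` \bigcup_(Z in F) Z) (u - v).
    move=> FZ Zu Zv; have [_ ZB _] := FP _ FZ.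
    by case: (ZB _ _ Zu Zv) => h; [left|right; exists Z].
  split.
  - by left.
  - move=> u v [Xu|[Z FZ Zu]] [Xv|[Z' FZ' Zv]].
    + by left; exact: XB.
    + by apply: (FB Z') => //; [left|right].
    + by apply: (FB Z) => //; [right|left].
    + case: (Ftot _ _ FZ FZ') => h.
        by apply: (FB Z') => //; right => //; exact: h.
      by apply: (FB Z) => //; right => //; exact: h.
  - move=> n u [Xu|[Z FZ Zu]]; first exact: XO.
    by have [_ _ ZO] := FP _ FZ; apply: ZO; right.
move=> Z [gZ Zmax]; exists (X `|` Z); split=> // b.
have [y yP] := admissible_exists b gZ; exists y.
have [X' [gX' ZX' X'b]] := bounded_graph_adjoin gZ yP.
apply: contrapT => nZ; apply: (Zmax X').
  split; first by move=> u Zu; apply: ZX'; right.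
  by move=> X'Z; apply: nZ; right; exact: X'Z.
rewrite /=; suff -> : X `|` X' = X' by [].
by apply/setUidPr => u Xu; apply: ZX'; left.
Qed.

Lemma bounded_graph_extension X : bounded_graph X ->
  exists h : {additive B -> I},
    (forall u, X u -> h u.1 = u.2) /\ (forall n b, b \in O n -> h b \in W n).
Proof.
move=> /bounded_graph_total[Y [[Y0 YB YO] XY Ytot]].
have [h hP] := choice Ytot.
have huniq u : Y u -> h u.1 = u.2.
  move=> Yu; apply/eqP; rewrite -subr_eq0; apply/eqP.
  have [_ sepW _ _] := pW; apply: sepW => n.
  apply: (YO n (_ - u) (YB _ _ (hP u.1) Yu)) => /=.
  by rewrite subrr rpred0.
have hadd : zmod_morphism h by move=> a b; exact: (huniq _ (YB _ _ (hP a) (hP b))).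
pose h' : {additive B -> I} := HB.pack h (GRing.isZmodMorphism.Build _ _ h hadd).
exists h'; split=> [u /XY|n b bO].
  exact: huniq.
exact: (YO n _ (hP b) bO).
Qed.

End extension.

(** * Injective objects and Yoneda Ext *)

Section injective_objects.
Context (R : realType) (p : nat) (p_prime : prime p).
Local Notation obj := (pab R p).

Definition nonarch_pab (G : topologicalZmodType) (U : nat -> zmodClosed G)
    (pU : nonarch_polish U) (tU : nonarch_ptorsion U p) : obj :=
  Pab (nonarch_polish_polish R pU) (nonarch_pro_p R pU tU).

Lemma pab_hom_eq (A B : obj) (f g : pab_hom A B) : (forall x, f x = g x) -> f = g.
Proof.
case: f g => [[f [[fP]]] fc] [[g [[gP]]] gc] /= fg.
have {}fg : f = g by apply/funext.
by case: _ / fg gP gc => gP gc; rewrite (Prop_irrelevance gP fP) in gc *;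
  rewrite (Prop_irrelevance gc fc).
Qed.

Lemma pab_homB (A B : obj) (f : pab_hom A B) x y : f (x - y) = f x - f y.
Proof. exact: raddfB. Qed.

Lemma pab_hom0 (A B : obj) (f : pab_hom A B) : f 0 = 0.
Proof. exact: raddf0. Qed.

Lemma pair_subE (G H : zmodType) (a c : G) (b d : H) :
  (a, b) - (c, d) = (a - c, b - d).
Proof. by []. Qed.

Lemma range_setT_surj (T V : Type) (g : T -> V) :
  range g = setT -> forall c, exists b, g b = c.
Proof.
by move=> gT c; have : setT c by []; rewrite -gT => -[b _ <-]; exists b.
Qed.

Lemma pab_surjective_open (B C : obj) (g : pab_hom B C) :
  range g = setT -> forall A, nbhs 0 A -> nbhs 0 (g @` A).
Proof.
move=> gT A nA; have [U [pU _]] := pab_nonarch B p_prime.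
have [V [pV _]] := pab_nonarch C p_prime.
have surjg := range_setT_surj gT.
have [[_ _ /(_ _ nA)[n nUA]] _ _ _] := pU.
apply: filterS (open_mapping pU pV (@hom_continuous _ _ _ _ g) surjg n).
exact: image_subset.
Qed.

Definition pdivisible_object (I : obj) := exists W : nat -> zmodClosed I,
  [/\ nonarch_polish W, forall x, x \in W 0%N & nonarch_pdivisible W p].

(** Since [A] carries the topology induced from [B], continuity of [h] picks for each n a level of
    [B] whose trace on [A] is sent into [W n]. Reindexing by these levels, made monotone by [M],
    turns the graph of [h] into a bounded one. *)
Lemma pdivisible_extension (I A B : obj) (f : pab_hom A B) (h : pab_hom A I) :
  pdivisible_object I -> embedding_onto_closed f ->
  exists k : pab_hom B I, forall a, k (f a) = h a.
Proof.
move=> [W [pW W0 dvW]] [finj _ fopen].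
have [U [[bU sepU compU sU] tU]] := pab_nonarch B p_prime.
have [[dW nW _] sepW _ _] := pW.
have ex n : exists m, forall a, f a \in U m -> h a \in W n.
  have /fopen[V oV fV] : open (h @^-1` [set` W n]).
    apply: open_comp => [x _|]; first exact: hom_continuous.
    exact: nbhs_subgroup_open.
  have V0 : nbhs 0 V.
    have [V0 _] : (V `&` range f) 0.
      by rewrite -fV; exists 0; rewrite /= ?raddf0// rpred0.
    by rewrite openE in oV; exact: oV.
  have [_ _ /(_ _ V0)[m mV]] := bU; exists m => a fa.
  have : (V `&` range f) (f a) by split; [exact: mV|exists a].
  by rewrite -fV => -[a' /= ha' /finj <-].
have [N NP] := choice ex.
pose M := fix M n := if n is n'.+1 then maxn (M n') (N n) else N 0%N.
pose O n := U (M n).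
have dO n x : x \in O n.+1 -> x \in O n.
  by apply: (nonarch_anti bU); rewrite leq_maxl.
have tO : nonarch_ptorsion O p by move=> n x; exact: tU.
have OP n a : f a \in O n -> h a \in W n.
  move=> fa; apply: NP; apply: (nonarch_anti bU _ fa).
  by case: n {fa} => //= n; rewrite leq_maxr.
have gX : bounded_graph O W [set u | exists a, u = (f a, h a)].
  split.
  - by exists 0; rewrite !pab_hom0.
  - by move=> _ _ [a ->] [b ->]; exists (a - b); rewrite pair_subE !pab_homB.
  - by move=> n _ [a ->] /=; exact: OP.
have [k [kX kO]] := bounded_graph_extension p_prime dO tO pW W0 dvW gX.
have ck : continuous k.
  apply: additive_continuous0 => D nD.
  have [[_ _ /(_ _ nD)[n nWD]] _ _ _] := pW; have [_ nU _] := bU.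
  by apply: filterS (nU (M n)) => b /= bO; apply: nWD; exact: kO.
by exists (Defs.Hom ck) => a; apply: (kX (f a, h a)); exists a.
Qed.

Lemma pab_factor (A B C I : obj) (f : pab_hom A B) (g : pab_hom B C)
    (h : pab_hom B I) : short_exact f g -> (forall a, h (f a) = 0) ->
  exists k : pab_hom C I, forall b, k (g b) = h b.
Proof.
move=> [_ fg gT] hf.
have surjg := range_setT_surj gT.
have [s sP] := choice surjg.
have hker b : g b = 0 -> h b = 0.
  move=> gb; have : [set b | g b = 0] b by [].
  by rewrite -fg => -[a _ <-]; exact: hf.
have kE b : h (s (g b)) = h b.
  by apply/eqP; rewrite -subr_eq0 -raddfB hker// raddfB sP subrr.
have kadd : zmod_morphism (h \o s).
  move=> c c'; have [b <-] := surjg c; have [b' <-] := surjg c'.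
  by rewrite /= -raddfB !kE raddfB.
pose k : {additive C -> I} := HB.pack (h \o s)
  (GRing.isZmodMorphism.Build _ _ (h \o s) kadd).
have ck : continuous k.
  apply: additive_continuous0 => D nD.
  have nhD : nbhs 0 (h @^-1` D) by apply: hom_continuous; rewrite raddf0.
  apply: filterS (pab_surjective_open gT nhD) => _ [b /= hb <-].
  by rewrite /= kE.
by exists (Defs.Hom ck) => b; exact: kE.
Qed.

Lemma pdivisible_injective (I : obj) : pdivisible_object I -> injective_object I.
Proof.
move=> dI A B C f g fgex; have [femb fg gT] := fgex; split.
- move=> k l kl; apply: pab_hom_eq => c.
  have : range g c by rewrite gT.
  by move=> [b _ <-]; exact: (congr1 (fun h : pab_hom B I => h b) kl).
- apply/seteqP; split=> [_ [k _ <-] a|h hf].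
    have : range f (f a) by exists a.
    by rewrite fg /= => ->; rewrite raddf0.
  have [k kP] := pab_factor fgex hf.
  by exists k => //; exact: pab_hom_eq.
- apply/seteqP; split=> // h _; have [k kP] := pdivisible_extension h dI femb.
  by exists k => //; exact: pab_hom_eq.
Qed.

Lemma injective_extension (I A B C : obj) (f : pab_hom A B) (g : pab_hom B C)
    (h : pab_hom A I) : injective_object I -> short_exact f g ->
  exists k : pab_hom B I, forall a, k (f a) = h a.
Proof.
move=> injI /injI[_ _ fT]; have : [set: pab_hom A I] h by [].
by rewrite -fT => -[k _ <-]; exists k.
Qed.

(** Packaged as a split extension with its retraction and the universal property of the product, so
    that chain maps into it can be given by components. *)
Lemma pab_biproduct (X Y : obj) : exists (P : extension Y X)
    (r : pab_hom (ext_mid P) X),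
  [/\ forall t, r (ext_inc P t) = t,
      forall u v, r u = r v -> ext_prj P u = ext_prj P v -> u = v &
      forall (T : obj) (a : pab_hom T X) (b : pab_hom T Y),
        exists e : pab_hom T (ext_mid P),
          forall t, r (e t) = a t /\ ext_prj P (e t) = b t].
Proof.
have [U [pU tU]] := pab_nonarch X p_prime; have [V [pV tV]] := pab_nonarch Y p_prime.
pose P := nonarch_pab (prod_nonarch_polish pU pV) (prod_ptorsion tU tV).
have [bP sepP compP sP] := prod_nonarch_polish pU pV.
have inl_add : zmod_morphism (fun x : X => ((x, 0) : P)).
  by move=> x y; congr (_, _); rewrite subr0.
pose inl : {additive X -> P} := HB.pack (fun x : X => ((x, 0) : P))
  (GRing.isZmodMorphism.Build _ _ _ inl_add).
have fst_add : zmod_morphism (fun z : P => z.1 : X) by [].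
pose fst' : {additive P -> X} := HB.pack (fun z : P => z.1 : X)
  (GRing.isZmodMorphism.Build _ _ _ fst_add).
have snd_add : zmod_morphism (fun z : P => z.2 : Y) by [].
pose snd' : {additive P -> Y} := HB.pack (fun z : P => z.2 : Y)
  (GRing.isZmodMorphism.Build _ _ _ snd_add).
have [[dU nU sU] _ _ _] := pU; have [[dV nV sV] _ _ _] := pV.
have inlU n a : a \in U n -> inl a \in prod_filtration pU pV n.
  by move=> aU; apply/in_prod_filtration; split=> //; exact: rpred0.
have inlU' n a : inl a \in prod_filtration pU pV n.+1 -> a \in U n.
  by move=> /in_prod_filtration[/dU].
have cinl : continuous inl by apply: (nonarch_continuous pU bP inlU).
have cfst : continuous fst'.
  apply: additive_continuous0 => D /sU[n nD]; apply/(nbhs_nonarch bP).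
  by exists n => z; rewrite subr0 => /in_prod_filtration[z1 _]; exact: nD.
have csnd : continuous snd'.
  apply: additive_continuous0 => D /sV[n nD]; apply/(nbhs_nonarch bP).
  by exists n => z; rewrite subr0 => /in_prod_filtration[_ z2]; exact: nD.
have ex : short_exact (Defs.Hom cinl : pab_hom X P) (Defs.Hom csnd : pab_hom P Y).
  split.
  - split.
    + exact: (nonarch_injective pU inlU').
    + exact: (nonarch_closed_range pU bP sepP inlU inlU').
    + exact: (nonarch_open_range pU bP inlU').
  - apply/seteqP; split=> [_ [x _ <-] //|[x y] /= y0].
    by exists x => //; congr (_, _).
  - by apply/seteqP; split=> // y _; exists (0, y).
exists (Extension ex), (Defs.Hom cfst : pab_hom P X); split=> //.
- by move=> [x y] [x' y'] /= -> ->.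
- move=> T a b.
  have eadd : zmod_morphism (fun t : T => ((a t, b t) : P)).
    by move=> x y; rewrite !pab_homB.
  pose e : {additive T -> P} := HB.pack (fun t : T => ((a t, b t) : P))
    (GRing.isZmodMorphism.Build _ _ _ eadd).
  have ce : continuous e.
    apply: additive_continuous0 => D nD; have [_ _ /(_ _ nD)[n nD']] := bP.
    have na : nbhs 0 (a @^-1` [set` U n]) by apply: hom_continuous; rewrite raddf0.
    have nb : nbhs 0 (b @^-1` [set` V n]) by apply: hom_continuous; rewrite raddf0.
    apply: filterS (filterI na nb) => t [/= at' bt]; apply: nD'.
    by apply/in_prod_filtration.
  by exists (Defs.Hom ce).
Qed.

End injective_objects.

(** * Vanishing of Ext in degrees at least 2 *)

Section yoneda_vanishing.
Context (R : realType) (p : nat) (p_prime : prime p).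
Local Notation obj := (pab R p).

Lemma zero_hom (A B : obj) : exists z : pab_hom A B, forall t, z t = 0.
Proof.
have cz : continuous (\0 : {additive A -> B}) by move=> x; exact: cvg_cst.
by exists (Defs.Hom cz).
Qed.

(* For [Q] injective, [Q -> Q * Q -> Q], ..., [Q -> Q * Q -> Q],
   [Q -> Q * A -> A] splice to an [n]-extension receiving maps from all others. *)
Lemma yoneda_terminal (n : nat) (A Q : obj) : injective_object Q ->
  exists t : yoneda n.+1 A Q, forall (Z : obj) (z : pab_hom Z Q)
    (x : yoneda n.+1 A Z), yoneda_map (hom_id A) z x t.
Proof.
move=> injQ; elim: n => [|n [t tP]].
  have [P [r [rinc runi rex]]] := pab_biproduct p_prime Q A.
  exists P => Z z x.
  have [k kP] := injective_extension z injQ (ext_exact x).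
  have [e eP] := rex _ k (ext_prj x).
  have [_ xker _] := ext_exact x; have [_ Pker _] := ext_exact P.
  exists e; split=> a; last by have [_ ->] := eP a.
  have [er ep] := eP (ext_inc x a); apply: runi; first by rewrite er kP rinc.
  rewrite ep; have : range (ext_inc x) (ext_inc x a) by exists a.
  rewrite xker /= => ->.
  have : range (ext_inc P) (ext_inc P (z a)) by exists (z a).
  by rewrite Pker /= => ->.
have [P [r [rinc runi rex]]] := pab_biproduct p_prime Q Q.
exists (existT _ Q (P, t)) => Z z [Z' [x y]].
have [k kP] := injective_extension z injQ (ext_exact x).
(* The second component of the middle map is chosen to be 0, so the induced map of cokernels is 0 as
   well; the induction hypothesis accepts any map there. *)
have [w wP] := zero_hom Z' Q; have [w' wP'] := zero_hom (ext_mid x) Q.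
have [e eP] := rex _ k w'.
have [_ Pker _] := ext_exact P.
exists w; split; last exact: tP.
exists e; split=> a; last by have [_ ->] := eP a; rewrite wP' wP.
have [er ep] := eP (ext_inc x a); apply: runi; first by rewrite er kP rinc.
rewrite ep wP'.
have : range (ext_inc P) (ext_inc P (z a)) by exists (z a).
by rewrite Pker /= => ->.
Qed.

(** The resolution of [B] spliced with the terminal extension of [A] by [Q] receives a map from
    every extension: extend [f] over the first middle term, pass to cokernels, then use terminality.
    Any two extensions are thus linked by one zigzag. *)
Lemma Ext_vanish (A B I Q : obj) (f : pab_hom B I) (g : pab_hom I Q) (n : nat) :
  short_exact f g -> injective_object I -> injective_object Q ->
  Ext_eq0 n.+2 A B.
Proof.
move=> fg injI injQ.
have [t tP] := yoneda_terminal n A injQ.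
have main (x : yoneda n.+2 A B) :
    yoneda_map (hom_id A) (hom_id B) x (existT _ Q (Extension fg, t)).
  case: x => Z [x y].
  have [k kP] := injective_extension f injI (ext_exact x).
  have [_ fker _] := fg.
  have [z zP] : exists z : pab_hom Z Q, forall b, z (ext_prj x b) = hom_comp g k b.
    apply: (pab_factor p_prime (ext_exact x)) => a /=.
    have : range f (f a) by exists a.
    by rewrite fker /= kP.
  exists z; split; last exact: tP.
  by exists k; split=> a; [exact: kP|rewrite /= zP].
move=> x y; apply: (@rst_trans _ _ _ (existT _ Q (Extension fg, t))).
  exact/rst_step/main.
exact/rst_sym/rst_step/main.
Qed.

End yoneda_vanishing.

(** * Divisible hulls *)

Section divisible_hull.
Context (p : nat) (p_prime : prime p).

Lemma coprime_torsion (G : zmodType) (N : zmodClosed G) (x : G) m k :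
  coprime m p -> x *+ m \in N -> x *+ (p ^ k)%N \in N -> x \in N.
Proof.
move=> mp xm xp.
have [a [b ab]] := Bezoutz (m : int) (p ^ k)%N.
have g1 : gcdz m (p ^ k)%N = 1.
  by congr Posz; apply/eqP; exact: (coprimeXr k mp).
have -> : x = (x *+ m) *~ a + (x *+ (p ^ k)%N) *~ b.
  rewrite !pmulrn -!mulrzA -mulrzDr [_ * a]mulrC [_ * b]mulrC.
  by rewrite [X in x *~ X](etrans ab g1).
by rewrite rpredD ?rpredMz.
Qed.

Local Notation P := {poly rat}.

Definition truncated_zero (m : nat) : set (nat -> P) :=
  [set f | forall i, (i < m)%N -> f i = 0].

Let trunc0 m : truncated_zero m 0.
Proof. by []. Qed.

Let truncB m f g : truncated_zero m f -> truncated_zero m g ->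
  truncated_zero m (f - g).
Proof.
move=> f0 g0 i im; have -> : (f - g) i = f i - g i by [].
by rewrite f0 ?g0 ?subr0.
Qed.

Let V m := subgroup_of_set (@trunc0 m) (@truncB m).

Let VE m f : (f \in V m) <-> forall i, (i < m)%N -> f i = 0.
Proof. exact: in_subgroup_of_set. Qed.

Let Vdecr m f : f \in V m.+1 -> f \in V m.
Proof. by move=> /VE h; apply/VE => i im; apply: h; exact: leqW. Qed.

(** A countable power of the discrete group Q[X], with one coordinate for each A / U n. The product
    of hulls is formed as a quotient of it, so that it inherits completeness and divisibility. *)
Definition polyseqs : topologicalZmodType := filtered Vdecr.

Definition polyseqs_filtration : nat -> zmodClosed polyseqs :=
  filtered_subgroup Vdecr.

Lemma in_polyseqs_filtration n (f : polyseqs) :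
  (f \in polyseqs_filtration n) <-> forall i, (i < n)%N -> f i = 0.
Proof.
by split=> [/in_filtered_subgroup/VE//|h]; apply/in_filtered_subgroup/VE.
Qed.

Lemma polyseqs_nonarch_polish : nonarch_polish polyseqs_filtration.
Proof.
split.
- exact: filtered_basis.
- move=> f h; apply/funext => i.
  by have /in_polyseqs_filtration/(_ i (ltnSn i)) := h i.+1.
- move=> x xV.
  have xS n i : (i < n)%N -> x n.+1 i = x n i.
    move=> im; have /in_polyseqs_filtration/(_ i im)/eqP := xV n.
    by rewrite subr_eq0 => /eqP.
  have xE n i : (i < n)%N -> x n i = x i.+1 i.
    move=> /subnK <-; elim: (n - i.+1)%N => // k IH.
    by rewrite addSn xS// ltn_addl.
  exists ((fun i => x i.+1 i) : polyseqs) => n; apply/in_polyseqs_filtration => i im.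
  by apply/eqP; rewrite subr_eq0; apply/eqP; rewrite xE.
- exists (fun k => if unpickle k is Some t then nth (0 : P) t else 0).
  move=> n f; exists (pickle (mkseq f n)); rewrite pickleK.
  apply/in_polyseqs_filtration => i im.
  by apply/eqP; rewrite subr_eq0; apply/eqP; rewrite nth_mkseq.
Qed.

Lemma polyseqs_pdivisible : nonarch_pdivisible polyseqs_filtration p.
Proof.
move=> n f /in_polyseqs_filtration fn.
have p0 : (p%:R : rat) != 0 by rewrite pnatr_eq0 -lt0n prime_gt0.
have mulE (g : polyseqs) k i : (g *+ k) i = g i *+ k.
  by elim: k => [|k IH] //; rewrite !mulrS -IH.
exists ((fun i => p%:R^-1 *: f i) : polyseqs).
  by apply/in_polyseqs_filtration => i /fn ->; rewrite scaler0.
apply/funext => i; rewrite mulE -scaler_nat scalerA mulfV// scale1r.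
done.
Qed.

Context (A : topologicalZmodType) (U : nat -> zmodClosed A) (s : nat -> A).
Hypothesis pU : nonarch_polish U.
Hypothesis tU : nonarch_ptorsion U p.
Hypothesis sU : forall n x, exists i, x - s i \in U n.

(** Not evaluation at a point: {poly int} serves as the free abelian group on the monomials, and
    this is the homomorphism sending 'X^i to [s i]. *)
Definition ev (Z : {poly int}) : A := \sum_(i < size Z) s i *~ Z`_i.

Lemma ev_widen (Z : {poly int}) N : (size Z <= N)%N ->
  ev Z = \sum_(i < N) s i *~ Z`_i.
Proof.
move=> ZN; rewrite /ev (big_ord_widen _ (fun i => s i *~ Z`_i) ZN).
rewrite big_mkcond /=; apply: eq_bigr => i _; case: ltnP => // iZ.
by rewrite nth_default// mulr0z.
Qed.

Lemma ev_is_additive : zmod_morphism ev.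
Proof.
move=> Y Z; pose N := maxn (size Y) (size Z).
rewrite (@ev_widen (Y - Z) N); last first.
  by rewrite (leq_trans (size_polyD _ _))// size_polyN.
rewrite (@ev_widen Y N) ?leq_maxl// (@ev_widen Z N) ?leq_maxr//.
rewrite -sumrB; apply: eq_bigr => i _.
by rewrite coefB mulrzBr.
Qed.

HB.instance Definition _ := GRing.isZmodMorphism.Build _ _ ev ev_is_additive.

Lemma evXn i : ev 'X^i = s i.
Proof.
rewrite /ev size_polyXn big_ord_recr /= coefXn eqxx mulr1z big1 ?add0r//.
by move=> j _; rewrite coefXn ltn_eqF// mulr0z.
Qed.

Local Notation rat_of := (map_poly (intr : int -> rat)).

Lemma rat_ofB (Y Z : {poly int}) : rat_of (Y - Z) = rat_of Y - rat_of Z.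
Proof. exact: raddfB. Qed.

Lemma evB (Y Z : {poly int}) : ev (Y - Z) = ev Y - ev Z.
Proof. exact: raddfB. Qed.

(* The quotient of Q[X] by [hull_rel n] is a divisible hull of the p-group
   A / U n, with 'X^i standing for s i. Allowing a multiple [m] prime to p kills
   the prime-to-p torsion that Q / Z would otherwise contribute. *)
Definition hull_rel (n : nat) : set P := [set Q | exists (m : nat) (Z : {poly int}),
  [/\ coprime m p, Q *+ m = rat_of Z & ev Z \in U n]].

Lemma hull_rel_int n (Z : {poly int}) : ev Z \in U n -> hull_rel n (rat_of Z).
Proof. by move=> ZU; exists 1%N, Z; rewrite coprime1n mulr1n. Qed.

Lemma hull_rel0 n : hull_rel n 0.
Proof. by rewrite -(raddf0 rat_of); apply: hull_rel_int; rewrite raddf0 rpred0. Qed.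

Lemma hull_relB n Q Q' : hull_rel n Q -> hull_rel n Q' -> hull_rel n (Q - Q').
Proof.
move=> [m [Z [mp QZ ZU]]] [l [Y [lp QY YU]]].
exists (m * l)%N, (Z *+ l - Y *+ m); split.
- by rewrite coprimeMl mp.
- by rewrite mulrnBl mulrnA QZ mulnC mulrnA QY raddfB !raddfMn.
- by rewrite evB (raddfMn ev l) (raddfMn ev m) rpredB ?rpredMn.
Qed.

(** This gives injectivity of A / U n into its hull: a multiple of [s i] prime to p lies in [U n],
    and so does a p-power multiple. *)
Lemma hull_relXn n i : hull_rel n 'X^i -> s i \in U n.
Proof.
move=> [m [Z [mp XZ ZU]]]; have [k sk] := tU n (s i).
apply: coprime_torsion mp _ sk; rewrite -evXn -raddfMn.
suff -> : 'X^i *+ m = Z by [].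
apply: (@map_inj_poly _ _ (intr : int -> rat)) => //; first exact: intr_inj.
by rewrite raddfMn /= map_polyXn.
Qed.

(** Only the p-part of a common denominator has to be cleared, as [hull_rel] absorbs the prime-to-p
    part; a further power of p brings the integral value into [U n]. *)
Lemma hull_rel_torsion n Q : exists k, hull_rel n (Q *+ (p ^ k)%N).
Proof.
have [N [Z [N0 QZ]]] : exists (N : nat) (Z : {poly int}),
    (0 < N)%N /\ Q *+ N = rat_of Z.
  have [Z [a a0 ->]] := rat_poly_scale Q.
  exists `|a|%N, (Z *~ sgz a); rewrite absz_gt0 a0; split=> //.
  rewrite -scaler_nat scalerA pmulrn abszEsg intrM -mulrA mulfV ?intr_eq0//.
  by rewrite mulr1 scaler_int raddfMz.
have [m mp NE] := pfactor_coprime p_prime N0.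
set j := logn p N in NE; have [l lU] := tU n (ev Z).
exists (j + l)%N, m, (Z *+ (p ^ l)%N); split.
- by rewrite coprime_sym.
- rewrite raddfMn /= -QZ NE -!mulrnA expnD; congr (_ *+ _).
  by rewrite mulnC mulnA.
- by rewrite raddfMn.
Qed.

Let K0 : [set f : polyseqs | forall n, hull_rel n (f n)] 0.
Proof. by move=> n; exact: hull_rel0. Qed.

Let KB (f g : polyseqs) : [set f : polyseqs | forall n, hull_rel n (f n)] f ->
  [set f : polyseqs | forall n, hull_rel n (f n)] g ->
  [set f : polyseqs | forall n, hull_rel n (f n)] (f - g).
Proof. by move=> fK gK n; exact: hull_relB. Qed.

Definition hull_kernel : zmodClosed polyseqs := subgroup_of_set K0 KB.

Lemma in_hull_kernel f : (f \in hull_kernel) <-> forall n, hull_rel n (f n).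
Proof. exact: in_subgroup_of_set. Qed.

Lemma hull_kernel_closed : closed [set` hull_kernel].
Proof.
move=> f fK; apply/in_hull_kernel => n.
have [bF _ _ _] := polyseqs_nonarch_polish.
have /fK[g [/= /in_hull_kernel gK gf]] :
    nbhs f [set g | g - f \in polyseqs_filtration n.+1].
  by apply/(nbhs_nonarch bF); exists n.+1.
have /in_polyseqs_filtration/(_ n (ltnSn n))/eqP := gf.
by rewrite subr_eq0 => /eqP <-.
Qed.

Definition hull : topologicalZmodType := tquot hull_kernel.

Definition hull_filtration : nat -> zmodClosed hull :=
  tquot_filtration polyseqs_filtration hull_kernel.

Lemma hull_nonarch_polish : nonarch_polish hull_filtration.
Proof. exact: tquot_nonarch_polish polyseqs_nonarch_polish hull_kernel_closed. Qed.

Lemma hull_filtration0 y : y \in hull_filtration 0.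
Proof.
have [f <-] := tquot_pi_surj y; apply/in_tquot_filtration.
by exists f => //; apply/in_polyseqs_filtration.
Qed.

Lemma hull_pdivisible : nonarch_pdivisible hull_filtration p.
Proof. exact: tquot_pdivisible polyseqs_pdivisible. Qed.

Lemma in_hull_filtration n (f : polyseqs) :
  (tquot_pi hull_kernel f \in hull_filtration n) <->
  forall i, (i < n)%N -> hull_rel i (f i).
Proof.
split=> [/in_tquot_filtration[g /in_polyseqs_filtration gn]|fn].
  move=> /esym/tquot_pi_eq/in_hull_kernel fg i im.
  have := fg i; have -> : (f - g) i = f i - g i by [].
  by rewrite gn// subr0.
apply/in_tquot_filtration.
exists ((fun i => if (i < n)%N then 0 else f i) : polyseqs).
  by apply/in_polyseqs_filtration => i ->.
apply/esym/tquot_pi_eq/in_hull_kernel => i.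
set g : polyseqs := fun i => _; have -> : (f - g) i = f i - g i by [].
rewrite /g; case: ifP => im; first by rewrite subr0; exact: fn.
by rewrite subrr; exact: hull_rel0.
Qed.

Lemma hull_ptorsion : nonarch_ptorsion hull_filtration p.
Proof.
move=> n y; have [f <-] := tquot_pi_surj y.
have mulE (g : polyseqs) k i : (g *+ k) i = g i *+ k.
  by elim: k => [|k IH] //; rewrite !mulrS -IH.
suff [k kP] : exists k, forall i, (i < n)%N -> hull_rel i (f i *+ (p ^ k)%N).
  exists k; rewrite -raddfMn; apply/in_hull_filtration => i im.
  by rewrite mulE; exact: kP.
have mulK i Q k : hull_rel i Q -> hull_rel i (Q *+ k).
  move=> [m [Z [mp QZ ZU]]]; exists m, (Z *+ k); split=> //.
    by rewrite -mulrnA mulnC mulrnA QZ raddfMn.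
  by rewrite raddfMn rpredMn.
elim: n => [|n [k kP]]; first by exists 0%N.
have [j jP] := hull_rel_torsion n (f n).
exists (k + j)%N => i; rewrite ltnS leq_eqVlt => /predU1P[->|/kP h].
  by rewrite expnD mulnC mulrnA; exact: mulK.
by rewrite expnD mulrnA; exact: mulK.
Qed.

(** Coordinate n of the image of [a] is the monomial of some [s i] congruent to [a] modulo [U n];
    this choice is additive only modulo [hull_kernel]. The index shift arises because level n+1 is
    the first to test coordinate n. *)
Lemma hull_embedding : exists f : {additive A -> hull},
  (forall n a, a \in U n -> f a \in hull_filtration n) /\
  (forall n a, f a \in hull_filtration n.+1 -> a \in U n).
Proof.
have [[dU _ _] _ _ _] := pU; have [bU _ _ _] := pU.
have ex (na : nat * A) : exists i, na.2 - s i \in U na.1 by exact: sU.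
have [ix ixP] := choice ex.
pose q (a : A) : polyseqs := fun n => 'X^(ix (n, a)).
have subE (g h : polyseqs) i : (g - h) i = g i - h i by [].
have fadd : zmod_morphism (fun a => tquot_pi hull_kernel (q a) : hull).
  move=> a b; rewrite -raddfB; apply/tquot_pi_eq/in_hull_kernel => n.
  have -> : (q (a - b) - (q a - q b)) n =
      rat_of ('X^(ix (n, a - b)) - ('X^(ix (n, a)) - 'X^(ix (n, b)))).
    by rewrite !rat_ofB !map_polyXn !subE.
  apply: hull_rel_int; rewrite !evB !evXn.
  have h1 := ixP (n, a - b); have h2 := ixP (n, a); have h3 := ixP (n, b).
  rewrite /= in h1 h2 h3.
  have -> : s (ix (n, a - b)) - (s (ix (n, a)) - s (ix (n, b))) =
     ((a - s (ix (n, a))) - (b - s (ix (n, b)))) - (a - b - s (ix (n, a - b))).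
    have z1 (x y z t : A) : x - y - (z - t) = x - z - (y - t).
      by rewrite !opprB addrACA [RHS]addrACA; congr (_ + _); exact: addrC.
    have z2 (d t r : A) : r - t = d - t - (d - r).
      by rewrite opprB [RHS]addrC addrA subrK.
    by rewrite (z1 a _ b); exact: z2.
  by rewrite rpredB// rpredB.
have qE n a : hull_rel n (q a n) <-> a \in U n.
  have h := ixP (n, a); rewrite /= in h; split=> [/hull_relXn sU'|aU].
    by rewrite -(subrK (s (ix (n, a))) a) rpredD.
  rewrite /q -(map_polyXn (intr : int -> rat)); apply: hull_rel_int.
  by rewrite evXn -(subKr a (s _)) rpredB.
pose f : {additive A -> hull} := HB.pack
  (fun a => tquot_pi hull_kernel (q a) : hull)
  (GRing.isZmodMorphism.Build _ _ _ fadd).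
exists f; split=> n a.
  move=> aU; apply/in_hull_filtration => i im; apply/qE.
  by apply: (nonarch_anti bU _ aU); exact: ltnW.
by move=> /in_hull_filtration/(_ n (ltnSn n))/qE.
Qed.

End divisible_hull.

(** * Homological dimension *)

Section dimension.
Context (R : realType) (p : nat) (p_prime : prime p).
Local Notation obj := (pab R p).

Lemma pdivisible_embedding (A : obj) : exists (I : obj) (f : pab_hom A I),
  pdivisible_object I /\ embedding_onto_closed f.
Proof.
have [U [pU tU]] := pab_nonarch A p_prime; have [_ _ _ [s sU]] := pU.
have pW := hull_nonarch_polish p U s; have [bW sepW _ _] := pW.
have tW : nonarch_ptorsion (hull_filtration p U s) p by exact: hull_ptorsion.
pose I : obj := nonarch_pab R pW tW.
have [f [fU fW]] := hull_embedding pU tU sU.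
have cf : continuous f by apply: (nonarch_continuous pU bW fU).
exists I, (@Defs.Hom R p A I f cf); split.
  exists (hull_filtration p U s); split=> //.
    exact: hull_filtration0.
  exact: hull_pdivisible.
split.
- exact: (nonarch_injective pU fW).
- exact: (nonarch_closed_range pU bW sepW fU fW).
- exact: (nonarch_open_range pU bW fW).
Qed.

Lemma pdivisible_cokernel (A I : obj) (f : pab_hom A I) :
  pdivisible_object I -> embedding_onto_closed f ->
  exists (Q : obj) (g : pab_hom I Q), pdivisible_object Q /\ short_exact f g.
Proof.
move=> [W [pW W0 dvW]] femb; have [finj fcl _] := femb.
have f0 : range f 0 by exists 0; rewrite ?pab_hom0.
have fB x y : range f x -> range f y -> range f (x - y).
  by move=> [a _ <-] [b _ <-]; exists (a - b); rewrite ?pab_homB.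
pose C := subgroup_of_set f0 fB.
have CE x : (x \in C) <-> range f x by exact: in_subgroup_of_set.
have clC : closed [set` C].
  have -> : [set` C] = range f by apply/seteqP; split=> x /CE.
  exact: fcl.
(* Torsion does not depend on the basis: each [W n] contains a level of the basis coming from the
   pro-p structure. *)
have tW : nonarch_ptorsion W p.
  have [U [[bU _ _ _] tU]] := pab_nonarch I p_prime => n x.
  have [[_ nW _] _ _ _] := pW; have [_ _ /(_ _ (nW n))[m mW]] := bU.
  by have [k xk] := tU m x; exists k; exact: mW.
have pQ := tquot_nonarch_polish pW clC.
pose Q : obj := nonarch_pab R pQ (tquot_ptorsion tW).
pose pi : {additive I -> tquot C} := tquot_pi C.
exists Q, (@Defs.Hom R p I Q pi (@tquot_pi_continuous I C)); split.
  exists (tquot_filtration W C); split=> //.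
    move=> y; have [x <-] := tquot_pi_surj y.
    by apply/in_tquot_filtration; exists x.
  exact: tquot_pdivisible.
split=> //.
- apply/seteqP; split=> x.
    move=> /CE xC; rewrite /= -(raddf0 (@tquot_pi I C)).
    by apply/tquot_pi_eq; rewrite subr0.
  rewrite /= -(raddf0 (@tquot_pi I C)) => /tquot_pi_eq.
  by rewrite subr0 => /CE.
- by apply/seteqP; split=> // y _; have [x <-] := tquot_pi_surj y; exists x.
Qed.

Lemma pab_enough_injectives : enough_injectives R p.
Proof.
move=> A; have [I [f [dI [finj fcl _]]]] := pdivisible_embedding A.
by exists I; [exact: (pdivisible_injective p_prime)|exists f].
Qed.

Lemma pab_Ext_vanish_above1 : Ext_vanish_above R p 1.
Proof.
move=> [|[|n]] // _ A B.
have [I [f [dI femb]]] := pdivisible_embedding B.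
have [Q [g [dQ fg]]] := pdivisible_cokernel dI femb.
by apply: (Ext_vanish p_prime fg); exact: (pdivisible_injective p_prime).
Qed.

(** * Nonvanishing of Ext in degree 1 *)

Lemma extension_map_id_bij (A B : obj) (x y : extension A B)
    (e : pab_hom (ext_mid x) (ext_mid y)) :
  (forall t, e (ext_inc x t) = ext_inc y t) ->
  (forall t, ext_prj y (e t) = ext_prj x t) ->
  (forall t, e t = 0 -> t = 0) /\ (forall u, exists t, e t = u).
Proof.
move=> einc eprj.
have [_ xker /range_setT_surj xsurj] := ext_exact x.
have [[yinj _ _] yker _] := ext_exact y; split=> [t et|u].
  have : range (ext_inc x) t by rewrite xker /= -eprj et pab_hom0.
  move=> [b _ bt]; rewrite -bt einc in et.
  suff b0 : b = 0 by rewrite -bt b0 pab_hom0.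
  by apply: yinj; rewrite et pab_hom0.
have [v vu] := xsurj (ext_prj y u).
have : range (ext_inc y) (u - e v).
  by rewrite yker /= pab_homB eprj vu subrr.
move=> [b _ bu]; exists (v + ext_inc x b).
by rewrite raddfD einc bu addrC subrK.
Qed.

(** An invariant of Yoneda classes that tells extensions apart: a map of extensions that is the
    identity at both ends is bijective in the middle, so divisibility transfers both ways. *)
Lemma yoneda_equiv_pdivisible (A B : obj) (x y : yoneda 1 A B) :
  yoneda_equiv x y ->
  ((forall u : ext_mid x, exists v, v *+ p = u) <->
   (forall u : ext_mid y, exists v, v *+ p = u)).
Proof.
elim=> {x y}.
- move=> x y [e [einc eprj]]; have [einj esurj] := extension_map_id_bij einc eprj.
  split=> [dx u|dy u].
    have [t <-] := esurj u; have [v <-] := dx t.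
    by exists (e v); rewrite raddfMn.
  have [w wu] := dy (e u); have [v ve] := esurj w; exists v.
  apply/eqP; rewrite -subr_eq0; apply/eqP; apply: einj.
  by rewrite pab_homB raddfMn ve wu subrr.
- by [].
- by move=> x y _ ->.
- by move=> x y z _ -> _ ->.
Qed.

Lemma exists_p_torsion_object : exists (B : obj) (b : B),
  b != 0 /\ forall x : B, x *+ p = 0.
Proof.
have S0 : [set 0 : 'F_p] 0 by [].
have SB (x y : 'F_p) : [set 0 : 'F_p] x -> [set 0 : 'F_p] y ->
    [set 0 : 'F_p] (x - y).
  by move=> /= -> ->; rewrite subr0.
pose V (n : nat) := subgroup_of_set S0 SB.
have VE n x : x \in V n <-> x = 0 by exact: in_subgroup_of_set.
have Vdecr n x : x \in V n.+1 -> x \in V n by move=> /VE ->; exact: rpred0.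
pose G : topologicalZmodType := filtered Vdecr.
pose U : nat -> zmodClosed G := filtered_subgroup Vdecr.
have UE n (x : G) : x \in U n <-> x = 0.
  by split=> [/in_filtered_subgroup/VE//|x0]; apply/in_filtered_subgroup/VE.
have Fp0 (x : 'F_p) : x *+ p = 0 by apply: mulrn_pchar; exact: pchar_Fp.
have G0 (x : G) : x *+ p = 0 by exact: Fp0.
have pG : nonarch_polish U.
  split.
  - exact: filtered_basis.
  - by move=> x /(_ 0%N)/UE.
  - move=> x xU; exists (x 0%N); elim=> [|n IH]; first by apply/UE; rewrite subrr.
    by rewrite -(subrKA (x n)) rpredD// -opprB rpredN.
  - exists (fun k => if unpickle k is Some y then (y : 'F_p) else 0) => n x.
    by exists (pickle (x : 'F_p)); rewrite pickleK; apply/UE; rewrite subrr.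
have tG : nonarch_ptorsion U p.
  by move=> n x; exists 1%N; apply/UE; rewrite expn1.
exists (nonarch_pab R pG tG), (1 : 'F_p); split=> //.
Qed.

Lemma pab_Ext1_neq0 : ~ Ext_vanish_above R p 0.
Proof.
have [B [b [b0 Bp]]] := exists_p_torsion_object.
have [I [f [dI femb]]] := pdivisible_embedding B.
have [Q [g [_ fg]]] := pdivisible_cokernel dI femb.
have [P [r [rinc _ _]]] := pab_biproduct p_prime B Q.
move=> /(_ 1%N isT Q B (Extension fg) P)/yoneda_equiv_pdivisible[dP _].
have [|v vP] := dP _ (ext_inc P b).
  move=> u; have [W [_ W0 dvW]] := dI.
  by have [v _ <-] := dvW 0%N u (W0 u); exists v.
(* If the biproduct were p-divisible, the retraction would exhibit [b] as a p-th multiple in [B],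
   where all such multiples vanish. *)
by case/eqP: b0; rewrite -(rinc b) -vP raddfMn Bp.
Qed.

End dimension.

Theorem corollary4p6 (R : realType) (p : nat) (p_prime : prime p) :
  enough_injectives R p /\ homological_dimension R p 1.
Proof.
split; first exact: pab_enough_injectives.
split; first exact: pab_Ext_vanish_above1.
by move=> [/(pab_Ext1_neq0 p_prime)|].
Qed.
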